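(* Let $H$ be a semisimple Hopf algebra over an algebraically closed field $K$ of characteristic zero, let $V$ be a finite-dimensional $H$-module with character $\chi$, and let $m$ be a natural number. Let $\alpha: V^{\otimes m}\to V^{\otimes m}$ be the linear map $v_1\otimes\cdots\otimes v_m\mapsto v_2\otimes v_3\otimes\cdots\otimes v_m\otimes v_1$. Then $$\nu_m(\chi) = \operatorname{tr}\bigl(\alpha|_{(V^{\otimes m})^H}\bigr).$$
   Context: A semisimple Hopf algebra is finite-dimensional, and contains a unique two-sided integral $\Lambda$ with $\varepsilon(\Lambda)=1$, where $\varepsilon$ is the counit. For $h\in H$ and $m\ge 1$, put $h^{[m]} := h_{(1)}h_{(2)}\cdots h_{(m)}$ (Sweedler notation for the iterated coproduct). The $m$-th Frobenius-Schur indicator of a character $\chi$ of $H$ is $\nu_m(\chi):=\chi(\Lambda^{[m]})$. The tensor power $V^{\otimes m}$ is an $H$-module via the diagonal action, and $(V^{\otimes m})^H=\{w : h.w=\varepsilon(h)w \text{ for all } h\in H\}$ is its subspace of invariants; this subspace is stable under $\alpha$ (because $\Lambda$ is cocommutative), so that the restriction of $\alpha$ to it makes sense. Modules are left modules. *)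

(* Defs.v *)
From HB Require Import structures.
From mathcomp Require Import all_boot all_order all_algebra all_field.

Set Implicit Arguments.
Unset Strict Implicit.
Unset Printing Implicit Defensive.

Import GRing.Theory.

Local Open Scope ring_scope.

(* The tensor power U^{(x) m} of a finite-dimensional space U, given by
   coordinates: with e = vbasis {:U}, an element t stands for
   \sum_f t f *: (e_(f 0) (x) ... (x) e_(f (m-1))), f : m.-tuple 'I_(dim U). *)
Notation tpow K U m := {ffun m.-tuple 'I_(\dim {:U}) -> K^o}.

Section TensorPower.
Variables (K : fieldType) (U : vectType K).
Implicit Types (W : lmodType K) (m : nat).

Local Notation T m := (tpow K U m).

Definition tens m (u : m.-tuple U) : T m :=
  [ffun f => \prod_(i < m) coord (vbasis {:U}) (tnth f i) (tnth u i)].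

(* The linear map out of U^{(x) m} induced by a multilinear g; see tlift_tens. *)
Definition tlift m W (g : m.-tuple U -> W) (t : T m) : W :=
  \sum_f t f *: g [tuple (vbasis {:U})`_(tnth f i) | i < m].

Fact tlift_is_linear m W (g : m.-tuple U -> W) : linear (tlift g).
Proof.
move=> a s t; rewrite /tlift scaler_sumr -big_split /=; apply: eq_bigr => f _.
by rewrite !ffunE scalerDl scalerA.
Qed.

HB.instance Definition _ m W (g : m.-tuple U -> W) :=
  GRing.isSemilinear.Build K (T m) W *:%R (tlift g)
    (GRing.semilinear_linear (tlift_is_linear g)).

Definition tset m (u : m.-tuple U) (i : 'I_m) (x : U) : m.-tuple U :=
  [tuple if j == i then x else tnth u j | j < m].

Definition multilinear m W (g : m.-tuple U -> W) : Prop :=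
  forall (u : m.-tuple U) (i : 'I_m), linear (fun x => g (tset u i x)).

Lemma tlift_tens m W (g : m.-tuple U -> W) (u : m.-tuple U) :
  multilinear g -> tlift g (tens u) = g u.
Proof.
elim: m => [|m IHm] in g u * => glin.
  rewrite /tlift (bigD1 [tuple]) //= big1 => [|f /eqP[]]; last exact: tuple0.
  by rewrite ffunE big_ord0 scale1r addr0; congr g; rewrite tuple0 [RHS]tuple0.
case/tupleP: u => x u; set e := vbasis {:U}.
have gE y : tlift (fun v : m.-tuple U => g [tuple of y :: v]) (tens u)
              = g [tuple of y :: u].
  apply: IHm => v i a p q /=.
  have cE z : [tuple of y :: tset v i z]
                = tset [tuple of y :: v] (lift ord0 i) z.
    apply: eq_from_tnth => j; rewrite tnth_mktuple.
    case: (unliftP ord0 j) => [k ->|->]; rewrite ?tnth0 //.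
    by rewrite !tnthS tnth_mktuple (inj_eq lift_inj).
  by rewrite !cE glin.
have lin0 : linear (fun y => g [tuple of y :: u]).
  have cE z : [tuple of z :: u] = tset [tuple of x :: u] ord0 z.
    apply: eq_from_tnth => j; rewrite tnth_mktuple.
    by case: (unliftP ord0 j) => [k ->|->]; rewrite ?tnth0 ?tnthS.
  by move=> a p q; rewrite /= (cE (a *: p + q)) (cE p) (cE q) glin.
have gxE : g [tuple of x :: u] =
    \sum_(j < \dim {:U}) coord e j x *: g [tuple of e`_j :: u].
  pose G : {linear U -> W} := HB.pack (fun y => g [tuple of y :: u])
    (GRing.isSemilinear.Build K U W *:%R _ (GRing.semilinear_linear lin0)).
  rewrite -[LHS]/(G x) [in LHS](coord_vbasis (memvf x)) linear_sum.
  by apply: eq_bigr => j _; rewrite linearZ.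
rewrite gxE.
under [RHS]eq_bigr => j _ do rewrite -gE /tlift scaler_sumr.
rewrite pair_big /= /tlift.
pose h (p : 'I_(\dim {:U}) * m.-tuple 'I_(\dim {:U})) := [tuple of p.1 :: p.2].
have hbij : bijective h.
  exists (fun f : m.+1.-tuple _ => (thead f, [tuple of behead f])).
    by case=> j f; congr pair; apply: val_inj.
  by case/tupleP=> j f; apply: val_inj.
rewrite (reindex h) /=; last exact: onW_bij.
apply: eq_bigr => -[j f] _; rewrite !ffunE big_ord_recl !tnth0 scalerA /=.
congr (_ * _ *: g _).
  by apply: eq_bigr => i _; rewrite !tnthS.
apply: eq_from_tnth => i; rewrite tnth_mktuple.
by case: (unliftP ord0 i) => [k ->|->]; rewrite ?tnth0 ?tnthS ?tnth_mktuple.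
Qed.

Lemma tens_multilinear m : multilinear (@tens m).
Proof.
move=> u i a x y; apply/ffunP=> f.
have tensE z : tens (tset u i z) f = coord (vbasis {:U}) (tnth f i) z *
    \prod_(j < m | j != i) coord (vbasis {:U}) (tnth f j) (tnth u j).
  rewrite ffunE (bigD1 i) //= tnth_mktuple eqxx; congr (_ * _).
  by apply: eq_bigr => j /negPf ji; rewrite tnth_mktuple ji.
by rewrite [RHS]ffunE [in RHS]ffunE !tensE linearP mulrDl -mulrA.
Qed.

Definition tcons m (x : U) (t : T m) : T m.+1 :=
  tlift (fun v : m.-tuple U => tens [tuple of x :: v]) t.

Definition trcons m (t : T m) (x : U) : T m.+1 :=
  tlift (fun v : m.-tuple U => tens [tuple of rcons v x]) t.

(* tlift2 F (comul h) is the Sweedler sum of F h_(1) h_(2). *)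
Definition tlift2 W (F : U -> U -> W) : T 2 -> W :=
  tlift (fun u : 2.-tuple U => F (tnth u ord0) (tnth u ord_max)).

Definition tmap m (f : m.-tuple 'End(U)) : 'End(T m) :=
  linfun (tlift (fun v : m.-tuple U =>
                   tens [tuple tnth f i (tnth v i) | i < m])).

Definition tcycle m : 'End(T m) :=
  linfun (tlift (fun v : m.-tuple U => tens [tuple of rot 1 v])).

Lemma tens_rot m (v : m.-tuple U) (f : m.-tuple 'I_(\dim {:U})) :
  tens [tuple of rot 1 v] f = tens v [tuple of rotr 1 f].
Proof.
pose c (p : 'I_(\dim {:U}) * U) := coord (vbasis {:U}) p.1 p.2.
have tE (w : m.-tuple U) (h : m.-tuple _) :
    tens w h = \prod_(p <- zip h w) c p.
  rewrite ffunE -[zip h w]/(tval [tuple of zip h w]) big_tuple.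
  by apply: eq_bigr => i _; rewrite
    (tnth_nth (tnth h i, tnth w i)) /= nth_zip ?size_tuple // -!tnth_nth.
have zip_rot1 (s : seq 'I_(\dim {:U})) (t : seq U) :
    size s = size t -> zip (rot 1 s) (rot 1 t) = rot 1 (zip s t).
  by case: s t => [|i s] [|x t] //= [st]; rewrite !rot1_cons zip_rcons.
rewrite !tE /= -[in LHS](rotrK 1 f) zip_rot1 ?size_rotr ?size_tuple //.
by apply: perm_big; rewrite perm_rot.
Qed.

Lemma tcycle_tens m (v : m.-tuple U) :
  tcycle m (tens v) = tens [tuple of rot 1 v].
Proof.
rewrite lfunE /= tlift_tens // => u i a x y /=.
apply/ffunP=> f; rewrite [RHS]ffunE [in RHS]ffunE !tens_rot.
by rewrite tens_multilinear [LHS]ffunE [in LHS]ffunE.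
Qed.

End TensorPower.

Definition lftrace (K : fieldType) (W : vectType K) (f : 'End(W)) : K :=
  \tr (passmx.mxof (vbasis {:W}) (vbasis {:W}) f).

(* vsproj only serves to land in W; see lfrestrE. *)
Definition lfrestr (K : fieldType) (U : vectType K) (W : {vspace U})
    (f : 'End(U)) : 'End(subvs_of W) :=
  linfun (vsproj W \o f \o vsval).

Lemma lfrestrE (K : fieldType) (U : vectType K) (W : {vspace U})
    (f : 'End(U)) (w : subvs_of W) :
  (f @: W <= W)%VS -> vsval (lfrestr W f w) = f (vsval w).
Proof.
move=> fW; rewrite lfunE /= vsprojK //.
by apply: (subvP fW); rewrite memv_img ?subvsP.
Qed.

Section HopfAlgebra.
Variables (K : fieldType) (H : falgType K).

Local Notation T m := (tpow K H m).

Definition tmul m (s t : T m) : T m :=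
  tlift (fun x : m.-tuple H =>
    tlift (fun y : m.-tuple H => tens [tuple tnth x i * tnth y i | i < m]) t) s.

Record hopf_structure := HopfStructure {
  comul : {linear H -> T 2};
  counit : {lrmorphism H -> K^o};
  antipode : {linear H -> H};
  comul1 : comul 1 = tens [tuple 1; 1];
  comulM : forall a b, comul (a * b) = tmul (comul a) (comul b);
  comulA : forall h,
    tlift2 (fun a b => trcons (comul a) b) (comul h) =
    tlift2 (fun a b => tcons a (comul b)) (comul h);
  counitl : forall h, tlift2 (fun a b => (counit a : K) *: b) (comul h) = h;
  counitr : forall h, tlift2 (fun a b => (counit b : K) *: a) (comul h) = h;
  antipodel : forall h,
    tlift2 (fun a b => antipode a * b) (comul h) = (counit h : K) *: 1;
  antipoder : forall h,
    tlift2 (fun a b => a * antipode b) (comul h) = (counit h : K) *: 1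
}.

Definition left_ideal (I : {vspace H}) : Prop :=
  forall a x, x \in I -> a * x \in I.

Definition semisimple : Prop :=
  forall I : {vspace H}, left_ideal I ->
  exists J : {vspace H},
    [/\ left_ideal J, (I + J)%VS = {:H}%VS & (I :&: J)%VS = 0%VS].

Variable D : hopf_structure.

Definition two_sided_integral (L : H) : Prop :=
  forall h, h * L = (counit D h : K) *: L /\ L * h = (counit D h : K) *: L.

(* h |-> h_(1) (x) ... (x) h_(n+1) *)
Fixpoint iter_comul (n : nat) : H -> T n.+1 :=
  if n is n'.+1
  then fun h => tlift2 (fun a b => tcons a (iter_comul n' b)) (comul D h)
  else fun h => tens [tuple h].

(* h |-> h_(1) (x) ... (x) h_(m), with the usual convention for m = 0. *)
Definition sweedler (m : nat) : H -> T m :=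
  if m is n.+1 then iter_comul n else fun h => (counit D h : K) *: tens [tuple].

Definition hopf_power (m : nat) (h : H) : H :=
  tlift (fun x : m.-tuple H => \prod_(y <- x) y) (sweedler m h).

Definition FS_indicator (L : H) (m : nat) (chi : H -> K) : K :=
  chi (hopf_power m L).

Record hmodule (V : vectType K) := HModule {
  hact :> {linear H -> 'End(V)};
  hact1 : hact 1 = \1%VF;
  hactM : forall a b, hact (a * b) = (hact a \o hact b)%VF
}.

Variables (V : vectType K) (rho : hmodule V).

Definition hchar (h : H) : K := lftrace (rho h).

Definition tpow_act (m : nat) (h : H) : 'End(tpow K V m) :=
  tlift (fun x : m.-tuple H => tmap [tuple rho (tnth x i) | i < m])
    (sweedler m h).

(* It is enough to test the condition on a basis of H; see tpow_invariantsP. *)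
Definition tpow_invariants (m : nat) : {vspace tpow K V m} :=
  let e := vbasis {:H} in
  (\bigcap_(i < \dim {:H})
     lker (tpow_act m e`_i - (counit D e`_i : K) *: \1%VF))%VS.

Fact sweedler_is_linear m : linear (sweedler m).
Proof.
case: m => [|n] a x y /=; first by rewrite linearP scalerDl scalerA.
case: n => [|n] /=; last by rewrite linearP /tlift2 linearP.
have E z : [tuple z] = tset [tuple (0 : H)] ord0 z.
  by apply: eq_from_tnth => i; rewrite tnth_mktuple ord1.
by rewrite (E (a *: x + y)) tens_multilinear -(E x) -(E y).
Qed.

Lemma tpow_invariantsP m (w : tpow K V m) :
  w \in tpow_invariants m <->
  forall h, tpow_act m h w = (counit D h : K) *: w.
Proof.
have kerE h : (w \in lker (tpow_act m h - (counit D h : K) *: \1%VF)) =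
              (tpow_act m h w == (counit D h : K) *: w).
  by rewrite memv_ker !lfunE /= opp_lfunE scale_lfunE id_lfunE subr_eq0.
rewrite memvE; split=> [/subv_bigcapP sub h | inv].
  have inv (i : 'I_(\dim {:H})) : tpow_act m (vbasis {:H})`_i w =
                 (counit D (vbasis {:H})`_i : K) *: w.
    by move: (sub i isT); rewrite -memvE kerE => /eqP.
  pose A h := tpow_act m h w - (counit D h : K) *: w.
  have Alin : linear A.
    move=> a x y; rewrite /A /tpow_act sweedler_is_linear !linearP.
    rewrite add_lfunE scale_lfunE scalerBr scalerDl scalerA opprD.
    by rewrite addrACA.
  pose B : {linear H -> tpow K V m} := HB.pack A
    (GRing.isSemilinear.Build K H (tpow K V m) *:%R _
      (GRing.semilinear_linear Alin)).
  apply/eqP; rewrite -subr_eq0 -[_ - _]/(B h) (coord_vbasis (memvf h)).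
  rewrite linear_sum big1 // => i _.
  by rewrite linearZ /= /A inv subrr scaler0.
by apply/subv_bigcapP=> i _; rewrite -memvE kerE inv.
Qed.

End HopfAlgebra.

(* Main.v *)
(* Let P be the action of L on V^(x)m. It projects onto the invariants, and
   Tr(alpha o P) = chi(L_(1) ... L_(m)) is a computation with matrix entries, so
   the point is that alpha preserves the invariants, i.e. that L is cocommutative.
   This rests on the Larson-Radford theorem S^2 = id, proved here from traces.

   - Write phi = S^2. The functionals h |-> Tr(x |-> h phi(x)) and
     h |-> Tr(x |-> phi(x) h) are one-sided integrals on H equal to 1 at L. Hence
     S is bijective, these functionals are nondegenerate and unique, and
     phi^2 = Ad(g^-1) for a grouplike g, which has finite order; so phi has finite
     order.
   - H being semisimple in characteristic 0, its regular trace form is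
     nondegenerate and represents the integral by a unit u; then phi = Ad(u).
     For a minimal central idempotent e, Tr(phi | eH) is y(eu) y(eu^-1) / y(e)
     where y is the regular character, and a power of eu is a scalar multiple of e,
     so this is of the form |w|^2 / y(e) with w in a cyclotomic field. As L is a
     central idempotent and Tr(phi | LH) = 1, the sum Tr(phi) is nonzero.
   - Tr(phi) <> 0 forces g = 1, so phi^2 = id. With f = y / dim H, which is an
     idempotent of the dual, Tr(phi) = dim H * Tr(phi o f) where phi o f is an
     involution on the image of f; so dim H divides Tr(phi), a nonzero integer of
     absolute value at most dim H, and phi = id.
   - When phi = id, the element of H given by the trace form of the dual algebra is
     cocommutative and equal to (dim H) L. *)

From HB Require Import structures.
Require Import Defs.
From mathcomp Require Import all_boot all_order all_algebra all_field.
From mathcomp Require Import cyclic.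

Set Implicit Arguments.
Unset Strict Implicit.
Unset Printing Implicit Defensive.

Import Order.TTheory GRing.Theory Num.Theory.

Local Open Scope ring_scope.

(** * Linear functions and traces *)

Section LinearFunctions.
Variables (K : fieldType) (U W : lmodType K) (f : U -> W).
Hypothesis lf : linear f.

Let g : {linear U -> W} := HB.pack f
  (GRing.isSemilinear.Build K U W *:%R f (GRing.semilinear_linear lf)).

Lemma linD x z : f (x + z) = f x + f z.
Proof. exact: (linearD g). Qed.
Lemma linB x z : f (x - z) = f x - f z.
Proof. exact: (linearB g). Qed.
Lemma linZ a x : f (a *: x) = a *: f x.
Proof. exact: (linearZ_LR g a x). Qed.
Lemma lin0 : f 0 = 0.
Proof. exact: (linear0 g). Qed.
Lemma lin_sum (I : Type) (r : seq I) (P : pred I) (F : I -> U) :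
  f (\sum_(i <- r | P i) F i) = \sum_(i <- r | P i) f (F i).
Proof. exact: (linear_sum g). Qed.

End LinearFunctions.

Section LinearRules.
Variable (K : fieldType).

Lemma lin_id (U : lmodType K) : linear (fun x : U => x).
Proof. by []. Qed.
Lemma lin_comp (U V W : lmodType K) (f : V -> W) (g : U -> V) :
  linear f -> linear g -> linear (fun x => f (g x)).
Proof. by move=> lf lg a x z; rewrite lg lf. Qed.
Lemma lin_bundled (U V : lmodType K) (f : {linear U -> V}) : linear f.
Proof. by move=> a x z; rewrite linearP. Qed.
Lemma lin_mull (U : lmodType K) (A : algType K) (f : U -> A) c :
  linear f -> linear (fun x => c * f x).
Proof. by move=> lf a x z; rewrite lf mulrDr scalerAr. Qed.
Lemma lin_mulr (U : lmodType K) (A : algType K) (f : U -> A) c :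
  linear f -> linear (fun x => f x * c).
Proof. by move=> lf a x z; rewrite lf mulrDl scalerAl. Qed.
Lemma lin_scalel (U V : lmodType K) (f : U -> K^o) (v : V) :
  linear f -> linear (fun x => (f x : K) *: v).
Proof. by move=> lf a x z; rewrite lf scalerDl scalerA. Qed.
Lemma lin_scaler (U V : lmodType K) (f : U -> V) (c : K) :
  linear f -> linear (fun x => c *: f x).
Proof. by move=> lf a x z; rewrite lf scalerDr !scalerA mulrC. Qed.
Lemma lin_add (U V : lmodType K) (f g : U -> V) :
  linear f -> linear g -> linear (fun x => f x + g x).
Proof. by move=> lf lg a x z; rewrite lf lg scalerDr addrACA. Qed.
Lemma lin_opp (U V : lmodType K) (f : U -> V) :
  linear f -> linear (fun x => - f x).
Proof. by move=> lf a x z; rewrite lf opprD scalerN. Qed.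
Lemma lin_bigsum (U V : lmodType K) (I : Type) (r : seq I) (P : pred I)
    (F : I -> U -> V) :
  (forall i, linear (F i)) -> linear (fun x => \sum_(i <- r | P i) F i x).
Proof.
move=> lF a x z; rewrite scaler_sumr -big_split /=.
by apply: eq_bigr => i _; rewrite lF.
Qed.
End LinearRules.

Section Trace.
Variable (K : fieldType).

(* Taken on plain functions, so that no linearity proof is needed to state
   identities between traces. *)
Definition ftr (U : vectType K) (f : U -> U) : K^o :=
  \sum_(i < \dim {:U}) coord (vbasis {:U}) i (f (vbasis {:U})`_i).

(** Allows the trace to be computed in any expansion x = sum c_i(x) b_i, in particular in a basis
    dual to [vbasis] under a trace form and in the tensor basis. *)
Lemma ftr_family (U : vectType K) (I : finType) (b : I -> U)
    (c : I -> U -> K^o) (f : U -> U) :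
  (forall i, linear (c i)) -> (forall x, x = \sum_i (c i x : K) *: b i) ->
  linear f -> ftr f = \sum_i c i (f (b i)).
Proof.
move=> lc bE lf; rewrite /ftr.
under eq_bigr => j _.
  rewrite [X in f X]bE (lin_sum lf) linear_sum /=.
  under eq_bigr => i _ do rewrite (linZ lf) linearZ /=.
  over.
rewrite exchange_big; apply: eq_bigr => i _ /=.
rewrite [in RHS](coord_vbasis (memvf (f (b i)))) (lin_sum (lc i)).
by apply: eq_bigr => j _; rewrite (linZ (lc i)) [LHS]mulrC.
Qed.

Lemma eq_ftr (U : vectType K) (f g : U -> U) : f =1 g -> ftr f = ftr g.
Proof. by move=> fg; apply: eq_bigr => i _; rewrite fg. Qed.

Lemma ftrC (U V : vectType K) (f : V -> U) (g : U -> V) :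
  linear f -> linear g -> ftr (fun x => f (g x)) = ftr (fun x => g (f x)).
Proof.
move=> lf lg; set e := vbasis {:V}.
rewrite /ftr; under eq_bigr => j _.
  rewrite [X in f X](coord_vbasis (memvf _)) (lin_sum lf) linear_sum /=.
  under eq_bigr => i _ do rewrite (linZ lf) linearZ /=.
  over.
rewrite exchange_big; apply: eq_bigr => i _ /=.
rewrite [in RHS](coord_vbasis (memvf (f _))) (lin_sum lg) linear_sum.
by apply: eq_bigr => j _; rewrite (linZ lg) linearZ [LHS]mulrC.
Qed.

Lemma ftrD (U : vectType K) (f g : U -> U) :
  ftr (fun x => f x + g x) = ftr f + ftr g.
Proof. by rewrite -big_split; apply: eq_bigr => i _; rewrite linearD. Qed.

Lemma ftrZ (U : vectType K) a (f : U -> U) :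
  ftr (fun x => a *: f x) = a * (ftr f : K).
Proof. by rewrite mulr_sumr; apply: eq_bigr => i _; rewrite linearZ. Qed.

Lemma ftr_sum (U : vectType K) (I : Type) (r : seq I) (P : pred I)
    (F : I -> U -> U) :
  ftr (fun x => \sum_(i <- r | P i) F i x) = \sum_(i <- r | P i) ftr (F i).
Proof.
by rewrite exchange_big; apply: eq_bigr => i _; rewrite linear_sum.
Qed.

Lemma lin_ftr (U : vectType K) (V : lmodType K) (F : V -> U -> U) :
  (forall x, linear (F^~ x)) -> linear (fun v => ftr (F v)).
Proof.
move=> lF; apply: lin_bigsum => i; apply: lin_comp (lF _).
exact: lin_bundled.
Qed.

Lemma lftrace_ftr (U : vectType K) (f : 'End(U)) : lftrace f = ftr f.
Proof.
rewrite /lftrace /mxtrace; apply: eq_bigr => i _.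
by rewrite !mxE /= passmx.vecof_delta.
Qed.

Lemma ftr_rank1 (U : vectType K) (p : U -> K^o) (v : U) :
  linear p -> ftr (fun x => (p x : K) *: v) = p v.
Proof.
move=> lp; rewrite [in RHS](coord_vbasis (memvf v)) (lin_sum lp) /ftr.
by apply: eq_bigr => i _; rewrite linearZ (linZ lp) [LHS]mulrC.
Qed.

Lemma ftr_id (U : vectType K) : ftr (fun x : U => x) = (\dim {:U})%:R.
Proof.
rewrite /ftr (eq_bigr (fun=> 1)) ?sumr_const ?card_ord //.
by move=> i _; rewrite coord_free ?eqxx // (basis_free (vbasisP _)).
Qed.

End Trace.

Lemma lin_bundle (K : fieldType) (U V : lmodType K) (f : U -> V) :
  linear f -> exists g : {linear U -> V}, forall x, g x = f x.
Proof.
move=> lf; pose g : {linear U -> V} := HB.pack f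
  (GRing.isSemilinear.Build K U V *:%R f (GRing.semilinear_linear lf)).
by exists g.
Qed.

Lemma inj_surj (K : fieldType) (U : vectType K) (f : U -> U) : linear f ->
  (forall x, f x = 0 -> x = 0) -> forall z, exists x, f x = z.
Proof.
move=> lf f0 z.
pose g : {linear U -> U} := HB.pack f
  (GRing.isSemilinear.Build K U U *:%R f (GRing.semilinear_linear lf)).
have ker0 : lker (linfun g) == 0%VS.
  apply/lker0P => x y; rewrite !lfunE /= => fxy; apply/eqP; rewrite -subr_eq0.
  by apply/eqP/f0; rewrite (linB lf) fxy subrr.
have : z \in limg (linfun g).
  suff -> : limg (linfun g) = fullv by apply: memvf.
  by apply/eqP; rewrite -dimv_leqif_eq ?subvf // limg_dim_eq // (eqP ker0) capv0.
by case/memv_imgP => x _ ->; exists x; rewrite lfunE.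
Qed.

Lemma functional_sep (K : fieldType) (U : vectType K) (x z : U) :
  (forall p : U -> K^o, linear p -> p x = p z) -> x = z.
Proof.
move=> pE; rewrite (coord_vbasis (memvf x)) (coord_vbasis (memvf z)).
by apply: eq_bigr => i _; rewrite (pE (coord (vbasis {:U}) i)) //; apply: lin_bundled.
Qed.

Lemma dim_subvs (K : fieldType) (U : vectType K) (W : {vspace U}) :
  \dim {:subvs_of W} = \dim W.
Proof. by rewrite dimvf. Qed.

(** The map is the inclusion of [W] after a map into [W], so cyclicity moves the trace to [W]. *)
Lemma ftr_subvs (K : fieldType) (U : vectType K) (W : {vspace U}) (f : U -> U) :
    linear f -> (forall x, f x \in W) ->
  ftr f = ftr (fun x : subvs_of W => vsproj W (f (vsval x))).
Proof.
move=> lf fW.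
rewrite (eq_ftr (g := fun x => vsval (vsproj W (f x)))); last first.
  by move=> x; rewrite vsprojK.
rewrite (ftrC (f := vsval) (g := fun x => vsproj W (f x))) //.
by move=> a x z; rewrite lf linearP.
Qed.

Lemma ftr_idem (K : fieldType) (U : vectType K) (f : U -> U) : linear f ->
    (forall x, f (f x) = f x) ->
  exists W : {vspace U},
    [/\ ftr f = (\dim W)%:R, forall x, f x \in W & forall x, x \in W -> f x = x].
Proof.
move=> lf ff; have [g gE] := lin_bundle lf.
exists (limg (linfun g)).
have fW x : f x \in limg (linfun g).
  by apply/memv_imgP; exists x; rewrite ?memvf // lfunE /= gE.
have fid x : x \in limg (linfun g) -> f x = x.
  by case/memv_imgP => y _ ->; rewrite lfunE /= gE ff.
split=> //; rewrite (ftr_subvs lf fW) -dim_subvs -ftr_id.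
by apply: eq_ftr => x; rewrite fid ?subvsP // vsvalK.
Qed.

(** The trace can be taken on the image, where the map vanishes. *)
Lemma ftr_sqr0 (K : fieldType) (U : vectType K) (f : U -> U) : linear f ->
  (forall x, f (f x) = 0) -> ftr f = 0.
Proof.
move=> lf ff; have [g gE] := lin_bundle lf.
rewrite (@ftr_subvs _ _ (limg (linfun g)) f lf); last first.
  by move=> x; apply/memv_imgP; exists x; rewrite ?memvf // lfunE /= gE.
rewrite (eq_ftr (g := fun=> 0)) /ftr ?big1 // => [i _|x]; first by rewrite linear0.
have /memv_imgP[y _ ->] := subvsP x.
by rewrite lfunE /= gE ff linear0.
Qed.

Lemma closed_eigenvector (K : closedFieldType) (U : vectType K) (f : U -> U) :
    linear f -> (0 < \dim {:U})%N ->
  exists a x, x != 0 /\ f x = a *: x.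
Proof.
move=> lf dU; have [g gE] := lin_bundle lf; pose e := vbasis {:U}.
pose A := passmx.mxof e e (linfun g).
have [|a] := @closed_rootP K (char_poly A) _.
  by rewrite size_char_poly; case: (\dim _) dU.
rewrite -eigenvalue_root_char => /eigenvalueP[v vE v0]; exists a, (passmx.vecof e v).
have eK : basis_of {:U} e by apply: vbasisP.
split; first by rewrite passmx.vecof_eq0 // (basis_free eK).
have := vE; rewrite passmx.mul_mxof lfunE /= gE => /(congr1 (passmx.vecof e)).
by rewrite passmx.rVofK // (linZ (passmx.vecof_linear _)).
Qed.

(** * Sweedler sums and the antipode *)

Definition bilin (K : fieldType) (U V W : lmodType K) (F : U -> V -> W) :=
  (forall b, linear (F^~ b)) /\ (forall a, linear (F a)).

Section MultilinearTensors.
Variables (K : fieldType) (H : vectType K) (W : lmodType K).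

Lemma multilinear2 (F : H -> H -> W) : bilin F ->
  multilinear (fun u : 2.-tuple H => F (tnth u ord0) (tnth u ord_max)).
Proof.
move=> [Fl Fr] u i; rewrite /tset; case: (unliftP ord0 i) => [j|] -> a x z.
  by rewrite (ord1 j) !tnth_mktuple /= Fr.
by rewrite !tnth_mktuple /= Fl.
Qed.

Lemma tlift2_tens (F : H -> H -> W) a b : bilin F ->
  tlift2 F (tens [tuple a; b]) = F a b.
Proof. by move=> bF; rewrite /tlift2 tlift_tens //; apply: multilinear2. Qed.

Lemma multilinear3 (G : H -> H -> H -> W) :
    (forall b c, linear (fun a => G a b c)) ->
    (forall a c, linear (fun b => G a b c)) ->
    (forall a b, linear (G a b)) ->
  multilinear (fun u : 3.-tuple H =>
    G (tnth u ord0) (tnth u (lift ord0 ord0)) (tnth u ord_max)).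
Proof.
move=> G1 G2 G3 u i; rewrite /tset; case: (unliftP ord0 i) => [j|] ->; last first.
  by move=> a x z; rewrite !tnth_mktuple /= G1.
case: (unliftP ord0 j) => [k|] -> a x z; rewrite !tnth_mktuple /= ?G2 //.
by rewrite (ord1 k) /= G3.
Qed.

Lemma lin_tlift m (g : m.-tuple H -> W) : linear (tlift g).
Proof. exact: tlift_is_linear. Qed.

Lemma tlift_comp m (V : lmodType K) (f : W -> V) (g : m.-tuple H -> W) t :
  linear f -> f (tlift g t) = tlift (fun u => f (g u)) t.
Proof.
move=> lf; rewrite /tlift (lin_sum lf); apply: eq_bigr => i _.
by rewrite (linZ lf).
Qed.

Lemma eq_tlift m (g g' : m.-tuple H -> W) t : g =1 g' -> tlift g t = tlift g' t.
Proof. by move=> gg; apply: eq_bigr => f _; rewrite gg. Qed.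

End MultilinearTensors.

(* [sw D F h] is the Sweedler sum of F h_(1) h_(2). *)
Definition sw (K : fieldType) (H : falgType K) (D : hopf_structure H)
  (W : lmodType K) (F : H -> H -> W) (h : H) : W := tlift2 F (comul D h).

Section SweedlerSums.
Variables (K : fieldType) (H : falgType K) (D : hopf_structure H).
Notation "'\sw_' ( a , b <- h ) E" := (sw D (fun a b => E) h)
  (at level 41, E at level 41, a name, b name, h at level 50,
   format "'[' \sw_ ( a ,  b  <-  h ) '/  '  E ']'").
Local Notation eps := (counit D).
Local Notation S := (antipode D).

Section SumRules.
Variables (W : lmodType K).
Implicit Types (F : H -> H -> W).

Lemma lin_sw F : linear (sw D F).
Proof. by move=> a x z; rewrite /sw linearP; apply: lin_tlift. Qed.

Lemma sw_comp (V : lmodType K) (f : W -> V) F h : linear f ->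
  f (sw D F h) = \sw_(a, b <- h) f (F a b).
Proof. exact: tlift_comp. Qed.

Lemma eq_sw F F' h : (forall a b, F a b = F' a b) -> sw D F h = sw D F' h.
Proof. by move=> FF; apply: eq_tlift => u; rewrite FF. Qed.

Lemma sw_exch (F : H -> H -> H -> H -> W) h k :
  \sw_(a, b <- h) \sw_(c, d <- k) F a b c d =
  \sw_(c, d <- k) \sw_(a, b <- h) F a b c d.
Proof.
rewrite /sw /tlift2 /tlift.
under eq_bigr => i _ do rewrite scaler_sumr.
rewrite exchange_big; apply: eq_bigr => i _; rewrite scaler_sumr.
by apply: eq_bigr => j _; rewrite !scalerA mulrC.
Qed.

Lemma lin_swF (V : lmodType K) (F : V -> H -> H -> W) h :
  (forall a b, linear (fun x => F x a b)) -> linear (fun x => sw D (F x) h).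
Proof. by move=> lF; apply: lin_bigsum => i; apply: lin_scaler; apply: lF. Qed.

Lemma sw_ftr (U : vectType K) (F : H -> H -> U -> U) h :
  \sw_(a, b <- h) ftr (F a b) = ftr (fun x => \sw_(a, b <- h) F a b x).
Proof.
rewrite /sw /tlift2 /tlift ftr_sum; apply: eq_bigr => i _.
by rewrite ftrZ.
Qed.

(** [comulA] equates coordinate tensors; evaluating the map induced by the trilinear [G] on both
    sides makes it a rule for Sweedler sums. *)
Lemma swA (G : H -> H -> H -> W) h :
    (forall b c, linear (fun a => G a b c)) ->
    (forall a c, linear (fun b => G a b c)) ->
    (forall a b, linear (G a b)) ->
  \sw_(a, c <- h) \sw_(a1, a2 <- a) G a1 a2 c =
  \sw_(a, c <- h) \sw_(c1, c2 <- c) G a c1 c2.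
Proof.
move=> G1 G2 G3; have mG := multilinear3 G1 G2 G3.
have := congr1 (tlift (fun u : 3.-tuple H =>
    G (tnth u ord0) (tnth u (lift ord0 ord0)) (tnth u ord_max))) (comulA D h).
rewrite !tlift_comp; try exact: lin_tlift.
set X := tlift _ _; set Y := tlift _ _ => eXY.
transitivity X; last transitivity Y => //.
  apply: eq_tlift => u; rewrite /trcons tlift_comp; last exact: lin_tlift.
  by apply: eq_tlift => -[[|a [|b []]] //= ?]; rewrite tlift_tens // !(tnth_nth 0).
apply: eq_tlift => u; rewrite /tcons tlift_comp; last exact: lin_tlift.
by apply: eq_tlift => -[[|a [|b []]] //= ?]; rewrite tlift_tens // !(tnth_nth 0).
Qed.

Lemma sw1 F : bilin F -> sw D F 1 = F 1 1.
Proof. by move=> bF; rewrite /sw comul1 tlift2_tens. Qed.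

Lemma swM F x z : bilin F ->
  sw D F (x * z) =
  \sw_(a, b <- x) \sw_(c, d <- z) F (a * c) (b * d).
Proof.
move=> bF; have mF := multilinear2 bF.
rewrite /sw comulM /tmul {1}/tlift2 tlift_comp; last exact: lin_tlift.
apply: eq_tlift => u; rewrite tlift_comp; last exact: lin_tlift.
by apply: eq_tlift => v; rewrite tlift_tens // !tnth_mktuple.
Qed.

Lemma sw_counitl (f : H -> W) h : linear f ->
  \sw_(a, b <- h) (eps a : K) *: f b = f h.
Proof.
move=> lf; rewrite -[in RHS](counitl D h) tlift_comp //.
by apply: eq_tlift => u; rewrite (linZ lf).
Qed.

Lemma sw_counitr (f : H -> W) h : linear f ->
  \sw_(a, b <- h) (eps b : K) *: f a = f h.
Proof.
move=> lf; rewrite -[in RHS](counitr D h) tlift_comp //.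
by apply: eq_tlift => u; rewrite (linZ lf).
Qed.

End SumRules.

Section AntipodeRules.
Variables (W : lmodType K).
Implicit Types (F : H -> H -> W).

Lemma sw_antipodel (f : H -> W) h : linear f ->
  \sw_(a, b <- h) f (S a * b) = (eps h : K) *: f 1.
Proof. by move=> lf; rewrite -sw_comp // /sw antipodel (linZ lf). Qed.

Lemma sw_antipoder (f : H -> W) h : linear f ->
  \sw_(a, b <- h) f (a * S b) = (eps h : K) *: f 1.
Proof. by move=> lf; rewrite -sw_comp // /sw antipoder (linZ lf). Qed.

Lemma sw_scale c F h : \sw_(a, b <- h) c *: F a b = c *: sw D F h.
Proof.
by symmetry; apply: (sw_comp (f := fun w => c *: w)); apply/lin_scaler/lin_id.
Qed.

End AntipodeRules.

End SweedlerSums.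

Lemma lin_bl (K : fieldType) (U V W : lmodType K) (F : U -> V -> W) b :
  bilin F -> linear (F^~ b).
Proof. by case=> Fl _; apply: Fl. Qed.

Lemma lin_br (K : fieldType) (U V W : lmodType K) (F : U -> V -> W) a :
  bilin F -> linear (F a).
Proof. by case=> _; apply. Qed.

(** Peels off the outermost operation of an expression whose linearity in the bound variable is
    wanted; most Sweedler rules leave such a side condition. *)
Ltac lin_step :=
  match goal with
  | |- bilin _ => split
  | |- forall _, _ => intro; cbv beta
  | H : ?P |- ?P => exact H
  | |- GRing.linear_for _ (fun x => x) => apply: lin_id
  | |- GRing.linear_for _ (fun x => sw ?D ?F (@?g x)) =>
      apply: (lin_comp (lin_sw D F) (g := g))
  | |- GRing.linear_for _ (fun x => sw ?D (@?F x) ?h) =>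
      apply: (lin_swF D (F := F) h)
  | |- GRing.linear_for _ (fun x => ftr _) => apply: lin_ftr
  | |- GRing.linear_for _ (fun x => ?c *: (@?f x)) => apply: (lin_scaler c (f := f))
  | |- GRing.linear_for _ (fun x => (@?f x) *: ?c) => apply: (lin_scalel c (f := f))
  | |- GRing.linear_for _ (fun x => ?c * (@?f x)) => apply: (lin_mull c (f := f))
  | |- GRing.linear_for _ (fun x => (@?f x) * ?c) => apply: (lin_mulr c (f := f))
  | |- GRing.linear_for _ (fun x => (@?f x) + (@?g x)) => apply: (lin_add (f := f) (g := g))
  | |- GRing.linear_for _ (fun x => - (@?f x)) => apply: (lin_opp (f := f))
  | H : GRing.linear_for _ ?f |- GRing.linear_for _ (fun x => ?f (@?g x)) =>
      apply: (lin_comp H (g := g))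
  | H : bilin ?F |- GRing.linear_for _ (fun x => ?F (@?g x) ?c) =>
      apply: (lin_comp (lin_bl c H) (g := g))
  | H : bilin ?F |- GRing.linear_for _ (fun x => ?F ?c (@?g x)) =>
      apply: (lin_comp (lin_br c H) (g := g))
  | |- GRing.linear_for _ (fun x => GRing.Linear.sort ?f (@?g x)) =>
      apply: (lin_comp (@lin_bundled _ _ _ f) (g := g))
  | |- GRing.linear_for _ (fun x => GRing.LRMorphism.sort ?f (@?g x)) =>
      apply: (lin_comp (@lin_bundled _ _ _ f) (g := g))
  end.
Ltac lin := cbv beta; do ?lin_step.

(** * The antipode as an anti-homomorphism of algebras and coalgebras, and its square *)

Section Antipode.
Variables (K : fieldType) (H : falgType K) (D : hopf_structure H).
Notation "'\sw_' ( a , b <- h ) E" := (sw D (fun a b => E) h)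
  (at level 41, E at level 41, a name, b name, h at level 50,
   format "'[' \sw_ ( a ,  b  <-  h ) '/  '  E ']'").
Local Notation eps := (counit D).
Local Notation S := (antipode D).
Lemma antipode1 : S 1 = 1.
Proof.
have := antipodel D 1; rewrite -/(sw D (fun a b => S a * b) 1).
by rewrite sw1 ?mulr1 ?rmorph1 ?scale1r //; lin.
Qed.

(** Both sides are convolution inverses of multiplication: the sum of S(a1 b1) a2 b2 S(b3) S(a3)
    collapses from its right end to one side and from its left end to the other. *)
Lemma antipodeM a b : S (a * b) = S b * S a.
Proof.
transitivity (\sw_(a1, a' <- a) \sw_(a2, a3 <- a') \sw_(b1, b' <- b)
   \sw_(b2, b3 <- b') (S (a1 * b1) * (a2 * b2) * (S b3 * S a3))).
  symmetry; under eq_sw => a1 a'.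
    under eq_sw => a2 a3.
      under eq_sw => b1 b'.
        under eq_sw => b2 b3 do rewrite mulrA -(mulrA (S _)) -(mulrA a2).
        rewrite (sw_antipoder D (f := fun z => S (a1 * b1) * (a2 * z) * S a3)); last by lin.
        over.
      rewrite (sw_counitr D (f := fun z => S (a1 * z) * (a2 * 1) * S a3)); last by lin.
      rewrite mulr1 -mulrA.
      over.
    rewrite (sw_antipoder D (f := fun z => S (a1 * b) * z)); last by lin.
    over.
  rewrite (sw_counitr D (f := fun z => S (z * b) * 1)); last by lin.
  by rewrite mulr1.
rewrite -(@swA _ _ D _ (fun a1 a2 a3 => \sw_(b1, b' <- b)
   \sw_(b2, b3 <- b') (S (a1 * b1) * (a2 * b2) * (S b3 * S a3)))); [|lin..].
under eq_sw => a' a3.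
  under eq_sw => a1 a2.
    rewrite -(@swA _ _ D _ (fun b1 b2 b3 => S (a1 * b1) * (a2 * b2) * (S b3 * S a3))); [|lin..].
    over.
  rewrite sw_exch.
  under eq_sw => b' b3.
    rewrite -(@swM _ _ D _ (fun x z => S x * z * (S b3 * S a3))); last by lin.
    rewrite (sw_antipodel D (f := fun x => x * (S b3 * S a3))); last by lin.
    rewrite rmorphM mul1r -scalerA.
    over.
  rewrite sw_scale (sw_counitl D (f := fun z => S z * S a3)); last by lin.
  over.
by rewrite (sw_counitl D (f := fun z => S b * S z)); last by lin.
Qed.

Lemma counit_antipode h : eps (S h) = eps h.
Proof.
rewrite -[in LHS](counitl D h) -/(sw D (fun a b => (eps a : K) *: b) h).
rewrite (sw_comp _ _ (f := fun z => eps (S z))); last by lin.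
transitivity (\sw_(a, b <- h) eps (a * S b)).
  by apply: eq_sw => a b; rewrite !linearZ rmorphM.
rewrite (sw_antipoder D (f := fun z => eps z)); last by lin.
by rewrite rmorph1 [LHS]mulr1.
Qed.

(** The same two-way collapse in the tensor square, for Delta(S h1) (h2 (x) h3) (S h5 (x) S h4). *)
Lemma sw_antipode (W : lmodType K) (F : H -> H -> W) h : bilin F ->
  sw D F (S h) = \sw_(a, b <- h) F (S b) (S a).
Proof.
move=> bF.
transitivity (\sw_(h1, u <- h) \sw_(h2, v <- u) \sw_(h3, w <- v)
   \sw_(h4, h5 <- w) \sw_(p, q <- S h1) F (p * (h2 * S h5)) (q * (h3 * S h4))).
  symmetry; under eq_sw => h1 u.
    under eq_sw => h2 v.
      rewrite -(@swA _ _ D _ (fun h3 h4 h5 =>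
        \sw_(p, q <- S h1) F (p * (h2 * S h5)) (q * (h3 * S h4)))); [|lin..].
      under eq_sw => a h5.
        rewrite (sw_antipoder D (f := fun z =>
          \sw_(p, q <- S h1) F (p * (h2 * S h5)) (q * z))); last by lin.
        over.
      rewrite (sw_counitl D (f := fun h5 =>
        \sw_(p, q <- S h1) F (p * (h2 * S h5)) (q * 1))); last by lin.
      over.
    rewrite (sw_antipoder D (f := fun z => \sw_(p, q <- S h1) F (p * z) (q * 1)));
      last by lin.
    over.
  rewrite (sw_counitr D (f := fun z => \sw_(p, q <- S z) F (p * 1) (q * 1)));
    last by lin.
  by apply: eq_sw => p q; rewrite !mulr1.
under eq_sw => h1 u.
  rewrite -(@swA _ _ D _ (fun h2 h3 w => \sw_(h4, h5 <- w)
    \sw_(p, q <- S h1) F (p * (h2 * S h5)) (q * (h3 * S h4)))); [|lin..].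
  over.
rewrite -(@swA _ _ D _ (fun h1 u w => \sw_(h2, h3 <- u) \sw_(h4, h5 <- w)
    \sw_(p, q <- S h1) F (p * (h2 * S h5)) (q * (h3 * S h4)))); [|lin..].
have collapse v w : \sw_(h1, u <- v) \sw_(h2, h3 <- u) \sw_(h4, h5 <- w)
      \sw_(p, q <- S h1) F (p * (h2 * S h5)) (q * (h3 * S h4)) =
    (eps v : K) *: \sw_(h4, h5 <- w) F (S h5) (S h4).
  transitivity (\sw_(h1, u <- v)
    (fun z => \sw_(h4, h5 <- w) \sw_(p, q <- z) F (p * S h5) (q * S h4)) (S h1 * u)).
    apply: eq_sw => h1 u.
    under [RHS]eq_sw => h4 h5.
      rewrite swM; last by lin.
      rewrite sw_exch.
      over.
    rewrite [RHS]sw_exch; apply: eq_sw => h2 h3; apply: eq_sw => h4 h5.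
    by apply: eq_sw => p q; rewrite !mulrA.
  rewrite (sw_antipodel D (f := fun z => \sw_(h4, h5 <- w)
    \sw_(p, q <- z) F (p * S h5) (q * S h4))); last by lin.
  congr (_ *: _); apply: eq_sw => h4 h5.
  by rewrite (sw1 D (F := fun p q => F (p * S h5) (q * S h4))) ?mul1r //; lin.
under eq_sw => v w do rewrite collapse.
by rewrite (sw_counitl D (f := fun w => \sw_(h4, h5 <- w) F (S h5) (S h4))); last by lin.
Qed.

Definition antipode2 (h : H) : H := S (S h).
Local Notation phi := antipode2.

Lemma lin_antipode2 : linear phi.
Proof. by rewrite /phi; lin. Qed.

Lemma antipode2M a b : phi (a * b) = phi a * phi b.
Proof. by rewrite /phi !antipodeM. Qed.

Lemma antipode2_1 : phi 1 = 1.
Proof. by rewrite /phi !antipode1. Qed.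

Lemma sw_antipode2 (W : lmodType K) (F : H -> H -> W) h : bilin F ->
  sw D F (phi h) = \sw_(a, b <- h) F (phi a) (phi b).
Proof. by move=> bF; rewrite /phi !sw_antipode //; lin. Qed.

Lemma counit_antipode2 h : eps (phi h) = eps h.
Proof. by rewrite /phi !counit_antipode. Qed.

Lemma lin_comul f : linear (fun h => (comul D h f : K^o)).
Proof. by move=> a x z; rewrite linearP !ffunE. Qed.

(* Cyclicity of the trace, when only one tensor leg is traced. *)
Lemma ftr_swap_r (q : H -> H -> K^o) (N : H -> H) : bilin q -> linear N ->
  ftr (fun x => \sw_(s, z <- x) \sw_(y1, y2 <- N z) (q y1 s : K) *: y2) =
  ftr (fun x => \sw_(y1, y2 <- x) \sw_(s, z <- y2) (q y1 s : K) *: N z).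
Proof.
move=> bq lN; pose e := vbasis {:H}.
pose ev (f : 2.-tuple 'I_(\dim {:H})) (i : 'I_2) :=
  tnth [tuple e`_(tnth f k) | k < 2] i.
have swE (W : lmodType K) (F : H -> H -> W) x :
    sw D F x = \sum_f comul D x f *: F (ev f ord0) (ev f ord_max) by [].
(* [comul D x f] is a coordinate of the coproduct of x. Expanding one coproduct in coordinates makes
   each side a sum of rank-one maps, and [ftr_rank1] gives both the same trace. *)
have -> : ftr (fun x => \sw_(s, z <- x) \sw_(y1, y2 <- N z) (q y1 s : K) *: y2) =
  \sum_f \sw_(y1, y2 <- N (ev f ord_max))
      ((q y1 (ev f ord0) : K) *: (comul D y2 f : K^o)).
  transitivity (\sum_f ftr (fun x => (comul D x f : K) *:
       \sw_(y1, y2 <- N (ev f ord_max)) (q y1 (ev f ord0) : K) *: y2)).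
    by rewrite -ftr_sum; apply: eq_ftr => x; rewrite swE.
  apply: eq_bigr => f _; rewrite ftr_rank1; last exact: lin_comul.
  have lc := lin_comul f.
  rewrite (sw_comp _ _ (f := fun y => (comul D y f : K^o))) //.
  by apply: eq_sw => a b; rewrite (linZ lc).
transitivity (\sum_f ftr (fun x => 
  ((\sw_(y1, y2 <- x) ((q y1 (ev f ord0) : K) *: (comul D y2 f : K^o))) : K)
    *: N (ev f ord_max))).
  apply: eq_bigr => f _; rewrite ftr_rank1 //.
  exact: lin_sw.
rewrite -ftr_sum; apply: eq_ftr => x.
under [RHS]eq_sw => y1 y2 do rewrite swE.
rewrite [in RHS]swE; under [RHS]eq_bigr => f _ do rewrite scaler_sumr.
rewrite exchange_big; apply: eq_bigr => f _ /=; rewrite swE scaler_suml.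
by apply: eq_bigr => k _; rewrite !scalerA; congr (_ *: _); rewrite [RHS]mulrAC.
Qed.

Lemma ftr_swap_l (q : H -> H -> K^o) (N : H -> H) : bilin q -> linear N ->
  ftr (fun x => \sw_(z, s <- x) \sw_(y1, y2 <- N z) (q y2 s : K) *: y1) =
  ftr (fun x => \sw_(y1, y2 <- x) \sw_(z, s <- y1) (q y2 s : K) *: N z).
Proof.
move=> bq lN; pose e := vbasis {:H}.
pose ev (f : 2.-tuple 'I_(\dim {:H})) (i : 'I_2) :=
  tnth [tuple e`_(tnth f k) | k < 2] i.
have swE (W : lmodType K) (F : H -> H -> W) x :
    sw D F x = \sum_f comul D x f *: F (ev f ord0) (ev f ord_max) by [].
have -> : ftr (fun x => \sw_(z, s <- x) \sw_(y1, y2 <- N z) (q y2 s : K) *: y1) =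
  \sum_f \sw_(y1, y2 <- N (ev f ord0))
      ((q y2 (ev f ord_max) : K) *: (comul D y1 f : K^o)).
  transitivity (\sum_f ftr (fun x => (comul D x f : K) *:
       \sw_(y1, y2 <- N (ev f ord0)) (q y2 (ev f ord_max) : K) *: y1)).
    by rewrite -ftr_sum; apply: eq_ftr => x; rewrite swE.
  apply: eq_bigr => f _; rewrite ftr_rank1; last exact: lin_comul.
  have lc := lin_comul f.
  rewrite (sw_comp _ _ (f := fun y => (comul D y f : K^o))) //.
  by apply: eq_sw => a b; rewrite (linZ lc).
transitivity (\sum_f ftr (fun x => 
  ((\sw_(y1, y2 <- x) ((q y2 (ev f ord_max) : K) *: (comul D y1 f : K^o))) : K)
    *: N (ev f ord0))).
  apply: eq_bigr => f _; rewrite ftr_rank1 //.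
  exact: lin_sw.
rewrite -ftr_sum; apply: eq_ftr => x.
under [RHS]eq_sw => y1 y2 do rewrite swE.
rewrite [in RHS]swE; under [RHS]eq_bigr => f _ do rewrite scaler_sumr.
rewrite exchange_big; apply: eq_bigr => f _ /=; rewrite swE scaler_suml.
by apply: eq_bigr => k _; rewrite !scalerA; congr (_ *: _); rewrite [RHS]mulrAC.
Qed.

End Antipode.

(** * Integrals obtained from traces *)

Section TraceIntegrals.
Variables (K : fieldType) (H : falgType K) (D : hopf_structure H).
Notation "'\sw_' ( a , b <- h ) E" := (sw D (fun a b => E) h)
  (at level 41, E at level 41, a name, b name, h at level 50,
   format "'[' \sw_ ( a ,  b  <-  h ) '/  '  E ']'").
Local Notation eps := (counit D).
Local Notation S := (antipode D).
Local Notation phi := (antipode2 D).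

(** Brings products of S and S^2 into a form where an antipode axiom applies; this is what the twist
    by phi in the integrals below is for. *)
Lemma antipode2_mul_antipode s c : phi c * S s = S (s * S c).
Proof. by rewrite antipodeM. Qed.

Lemma antipode_mul_antipode2 s d : S s * phi d = S (S d * s).
Proof. by rewrite antipodeM. Qed.

(** [lint] will be a left and [rint] a right integral in the dual algebra, whose product is
    convolution. *)
Definition lint (h : H) : K^o := ftr (fun x => h * phi x).
Definition rint (h : H) : K^o := ftr (fun x => phi x * h).
Definition regchar (h : H) : K^o := ftr (fun x => h * x).
Local Notation lam := lint.
Local Notation lam' := rint.
Local Notation chreg := regchar.

Lemma lin_lint : linear lam.
Proof. by rewrite /lam /phi; lin. Qed.
Lemma lin_rint : linear lam'.
Proof. by rewrite /lam' /phi; lin. Qed.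
Lemma lin_regchar : linear chreg.
Proof. by rewrite /chreg; lin. Qed.

(** Tested against a functional [p]. As phi(x2) S(x1) = S(x1 S(x2)), the term p(h1) h2 phi(x) arises
    from the coproduct of h phi(x2) by multiplying the first leg by S(x1) and applying [p].
    Cyclicity turns it into p(x1 S(x2)) h phi(x3), which collapses to p(1) h phi(x). *)
Lemma lint_integral h : \sw_(a, b <- h) (lam b : K) *: a = (lam h : K) *: 1.
Proof.
have lphi := lin_antipode2 D; have llam := lin_lint.
apply: functional_sep => p lp; rewrite (linZ lp) (sw_comp _ _ (f := p)) //.
transitivity (ftr (fun x => \sw_(a, b <- h) (p a : K) *: (b * phi x))).
  rewrite -sw_ftr; apply: eq_sw => a b.
  by rewrite (linZ lp) ftrZ -/(lam b) [LHS]mulrC.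
transitivity (ftr (fun x => \sw_(s, z <- x) \sw_(y1, y2 <- h * phi z)
   (p (y1 * S s) : K) *: y2)).
  apply: eq_ftr => x; symmetry.
  under eq_sw => s z.
    rewrite swM; last by lin.
    under eq_sw => a b do (rewrite sw_antipode2; last by lin).
    over.
  rewrite sw_exch; apply: eq_sw => a b.
  rewrite -(@swA _ _ D _ (fun s c d => (p (a * phi c * S s) : K) *: (b * phi d)));
    [|lin..].
  under eq_sw => u d.
    under eq_sw => s c do rewrite -mulrA antipode2_mul_antipode.
    rewrite (sw_antipoder D (f := fun w => (p (a * S w) : K) *: (b * phi d)));
      last by lin.
    over.
  rewrite (sw_counitl D (f := fun d => (p (a * S 1) : K) *: (b * phi d))); last by lin.
  by rewrite antipode1 mulr1.
rewrite (ftr_swap_r D (q := fun y1 s => p (y1 * S s)) (N := fun z => h * phi z));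
  [|by lin..].
rewrite -[RHS]mulrC -ftrZ; apply: eq_ftr => x.
rewrite -(@swA _ _ D _ (fun y1 s z => (p (y1 * S s) : K) *: (h * phi z))); [|lin..].
under eq_sw => u z.
  rewrite (sw_antipoder D (f := fun w => (p w : K) *: (h * phi z))); last by lin.
  over.
by rewrite (sw_counitl D (f := fun z => (p 1 : K) *: (h * phi z))); last by lin.
Qed.

(** Mirror image of [lint_integral], resting on S(x3) phi(x2) = S(S(x2) x3). *)
Lemma rint_integral h : \sw_(a, b <- h) (lam' a : K) *: b = (lam' h : K) *: 1.
Proof.
have lphi := lin_antipode2 D; have llam := lin_rint.
apply: functional_sep => p lp; rewrite (linZ lp) (sw_comp _ _ (f := p)) //.
transitivity (ftr (fun x => \sw_(a, b <- h) (p b : K) *: (phi x * a))).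
  rewrite -sw_ftr; apply: eq_sw => a b.
  by rewrite (linZ lp) ftrZ -/(lam' a) [LHS]mulrC.
transitivity (ftr (fun x => \sw_(z, s <- x) \sw_(y1, y2 <- phi z * h)
   (p (S s * y2) : K) *: y1)).
  apply: eq_ftr => x; symmetry.
  under eq_sw => z s.
    rewrite swM; last by lin.
    rewrite sw_antipode2; last by lin.
    over.
  rewrite (@swA _ _ D _ (fun c d s => \sw_(a, b <- h)
    (p (S s * (phi d * b)) : K) *: (phi c * a))); [|lin..].
  under eq_sw => c u.
    under eq_sw => d s.
      under eq_sw => a b do rewrite mulrA antipode_mul_antipode2.
      over.
    rewrite (sw_antipodel D (f := fun w => \sw_(a, b <- h)
      (p (S w * b) : K) *: (phi c * a))); last by lin.
    over.
  rewrite (sw_counitr D (f := fun c => \sw_(a, b <- h)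
    (p (S 1 * b) : K) *: (phi c * a))); last by lin.
  by rewrite antipode1; apply: eq_sw => a b; rewrite mul1r.
rewrite (ftr_swap_l D (q := fun y2 s => p (S s * y2)) (N := fun z => phi z * h));
  [|by lin..].
rewrite -[RHS]mulrC -ftrZ; apply: eq_ftr => x.
rewrite (@swA _ _ D _ (fun z s y2 => (p (S s * y2) : K) *: (phi z * h))); [|lin..].
under eq_sw => z u.
  rewrite (sw_antipodel D (f := fun w => (p w : K) *: (phi z * h))); last by lin.
  over.
by rewrite (sw_counitr D (f := fun z => (p 1 : K) *: (phi z * h))); last by lin.
Qed.

Lemma regcharC a b : chreg (a * b) = chreg (b * a).
Proof.
rewrite /chreg; transitivity (ftr (fun x => a * (b * x))).
  by apply: eq_ftr => x; rewrite mulrA.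
rewrite (ftrC (f := fun x => a * x) (g := fun x => b * x)); [|by lin..].
by apply: eq_ftr => x; rewrite mulrA.
Qed.

Lemma regchar1 : chreg 1 = (\dim {:H})%:R.
Proof. by rewrite -ftr_id; apply: eq_ftr => x; rewrite mul1r. Qed.

(** The character form of the freeness of H (x) H, of rank dim H; it makes chreg / dim H an
    idempotent of the dual algebra. The insertion argument is that of the trace integrals, with the
    cyclicity of [chreg] at the end. *)
Lemma regchar_conv h :
  \sw_(a, b <- h) (chreg b : K) *: chreg a = (chreg 1 : K) *: chreg h.
Proof.
have lc := lin_regchar.
transitivity (ftr (fun x => \sw_(a, b <- h) (chreg b : K) *: (a * x))).
  by rewrite -sw_ftr; apply: eq_sw => a b; rewrite ftrZ.
transitivity (ftr (fun x => \sw_(z, s <- x) \sw_(y1, y2 <- h * z)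
   (chreg (y2 * S s) : K) *: y1)).
  apply: eq_ftr => x; symmetry.
  under eq_sw => z s.
    rewrite swM; last by lin.
    over.
  rewrite sw_exch; apply: eq_sw => a b.
  rewrite (@swA _ _ D _ (fun c d s => (chreg (b * d * S s) : K) *: (a * c)));
    [|lin..].
  under eq_sw => c u.
    under eq_sw => d s do rewrite -mulrA.
    rewrite (sw_antipoder D (f := fun w => (chreg (b * w) : K) *: (a * c)));
      last by lin.
    over.
  rewrite (sw_counitr D (f := fun c => (chreg (b * 1) : K) *: (a * c))); last by lin.
  by rewrite mulr1.
rewrite (ftr_swap_l D (q := fun y2 s => chreg (y2 * S s)) (N := fun z => h * z));
  [|by lin..].
rewrite [RHS](_ : _ = ftr (fun x => chreg 1 *: (h * x))); last by rewrite ftrZ.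
apply: eq_ftr => x.
rewrite (@swA _ _ D _ (fun z s y2 => (chreg (y2 * S s) : K) *: (h * z))); [|lin..].
under eq_sw => z u.
  under eq_sw => s y2 do rewrite regcharC.
  rewrite (sw_antipodel D (f := fun w => (chreg w : K) *: (h * z))); last by lin.
  over.
by rewrite (sw_counitr D (f := fun z => (chreg 1 : K) *: (h * z))); last by lin.
Qed.

(* The integral of H given by traces on the dual: <p, cotr> is the trace of
   x |-> p x_(1) phi(x_(2)). *)
Definition cotr : H := \sum_(i < \dim {:H})
  \sw_(a, b <- (vbasis {:H})`_i) (coord (vbasis {:H}) i (phi b) : K) *: a.

Lemma cotrE (p : H -> K^o) : linear p ->
  p cotr = ftr (fun x => \sw_(a, b <- x) (p a : K) *: phi b).
Proof.
move=> lp; rewrite /cotr (lin_sum lp); apply: eq_bigr => i _.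
pose c : H -> K^o := coord (vbasis {:H}) i; have lc : linear c by exact: lin_bundled.
rewrite (sw_comp _ _ (f := p)) // -/(c _) (sw_comp _ _ (f := c)) //.
by apply: eq_sw => a b; rewrite (linZ lp) (linZ lc) [LHS]mulrC.
Qed.

(** Since S(h3) phi(h2) = S(S(h2) h3), the term p(h x1) phi(x2) equals p(h1 x1) S(h3) phi(h2 x2).
    Cyclicity moves the factor S(h3) to the argument, where h1 S(h2) collapses inside the
    coproduct. *)
Lemma mul_cotr h : h * cotr = (eps h : K) *: cotr.
Proof.
have lphi := lin_antipode2 D.
apply: functional_sep => p lp; rewrite (linZ lp).
rewrite (cotrE (p := fun z => p (h * z))); last by lin.
transitivity (ftr (fun x => \sw_(u, h3 <- h) 
   (S h3 * \sw_(a, b <- u * x) (p a : K) *: phi b))).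
  apply: eq_ftr => x; symmetry.
  under eq_sw => u h3.
    rewrite (sw_comp _ _ (f := fun w => S h3 * w)); last by lin.
    rewrite swM; last by lin.
    over.
  rewrite (@swA _ _ D _ (fun c d h3 => \sw_(a, b <- x)
    S h3 * ((p (c * a) : K) *: phi (d * b)))); [|lin..].
  under eq_sw => c w.
    under eq_sw => d h3.
      under eq_sw => a b do rewrite -scalerAr antipode2M mulrA antipode_mul_antipode2.
      over.
    rewrite (sw_antipodel D (f := fun w => \sw_(a, b <- x)
       ((p (c * a) : K) *: (S w * phi b)))); last by lin.
    over.
  rewrite (sw_counitr D (f := fun c => \sw_(a, b <- x)
       ((p (c * a) : K) *: (S 1 * phi b)))); last by lin.
  by apply: eq_sw => a b; rewrite antipode1 mul1r.
transitivity (\sw_(u, h3 <- h) ftr (fun x =>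
    \sw_(a, b <- u * (S h3 * x)) (p a : K) *: phi b)).
  rewrite -sw_ftr; apply: eq_sw => u h3.
  by rewrite (ftrC (f := fun x => S h3 * x)
    (g := fun x => \sw_(a, b <- u * x) (p a : K) *: phi b)); [|by lin..].
under eq_sw => u h3.
  rewrite (eq_ftr (g := fun x => \sw_(a, b <- u * S h3 * x) (p a : K) *: phi b));
    last by move=> x; rewrite mulrA.
  over.
rewrite (sw_antipoder D (f := fun w => ftr (fun x =>
    \sw_(a, b <- w * x) (p a : K) *: phi b))); last by lin.
congr (_ *: _); rewrite cotrE //.
by apply: eq_ftr => x; rewrite mul1r.
Qed.

Lemma counit_cotr : eps cotr = ftr phi.
Proof.
have lphi := lin_antipode2 D.
rewrite (cotrE (p := eps)); last exact: lin_bundled.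
by apply: eq_ftr => x; rewrite sw_counitl.
Qed.
End TraceIntegrals.

(** * Nondegeneracy and uniqueness of integrals, the distinguished grouplike, and the formula for
    S^4 *)

Section IntegralTheory.
Variables (K : fieldType) (H : falgType K) (D : hopf_structure H).
Notation "'\sw_' ( a , b <- h ) E" := (sw D (fun a b => E) h)
  (at level 41, E at level 41, a name, b name, h at level 50,
   format "'[' \sw_ ( a ,  b  <-  h ) '/  '  E ']'").
Local Notation eps := (counit D).
Local Notation S := (antipode D).
Local Notation phi := (antipode2 D).
Local Notation lam := (lint D).
Local Notation lam' := (rint D).
Section Integral.
Variable L : H.
Hypothesis intL : two_sided_integral D L.
Hypothesis epsL : eps L = 1.

Let lphi := lin_antipode2 D.
Let llam := lin_lint D.
Let llam' := lin_rint D.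

(** For an integral the traced map is x |-> eps(x) L, of rank one. *)
Lemma lint_L : lam L = 1.
Proof.
rewrite /lint (eq_ftr (g := fun x => (eps x : K) *: L)).
  by rewrite ftr_rank1 //; apply: lin_bundled.
by move=> x; rewrite (intL _).2 counit_antipode2.
Qed.

Lemma rint_L : lam' L = 1.
Proof.
rewrite /rint (eq_ftr (g := fun x => (eps x : K) *: L)).
  by rewrite ftr_rank1 //; apply: lin_bundled.
by move=> x; rewrite (intL _).1 counit_antipode2.
Qed.

(** Two evaluations of S(x1) x2 L1 (x) x3 L2: the integral absorbs x2 and x3, or S(x1) x2
    collapses. *)
Lemma sw_integral (W : lmodType K) (F : H -> H -> W) x : bilin F ->
  \sw_(a, b <- L) F (S x * a) b = \sw_(a, b <- L) F a (x * b).
Proof.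
move=> bF.
transitivity (\sw_(x1, w <- x) \sw_(x2, x3 <- w) \sw_(a, b <- L)
   F (S x1 * x2 * a) (x3 * b)); last first.
  rewrite -(@swA _ _ D _ (fun x1 x2 x3 => \sw_(a, b <- L)
    F (S x1 * x2 * a) (x3 * b))); [|lin..].
  under eq_sw => u x3.
    rewrite (sw_antipodel D (f := fun z => \sw_(a, b <- L) F (z * a) (x3 * b)));
      last by lin.
    over.
  rewrite (sw_counitl D (f := fun z => \sw_(a, b <- L) F (1 * a) (z * b)));
    last by lin.
  by apply: eq_sw => a b; rewrite mul1r.
symmetry; under eq_sw => x1 w.
  under eq_sw => x2 x3.
    under eq_sw => a b do rewrite -mulrA.
    over.
  rewrite -(swM D (F := fun a b => F (S x1 * a) b)); last by lin.
  rewrite (intL _).1 (linZ (lin_sw _ _)).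
  over.
by rewrite (sw_counitr D (f := fun z => \sw_(a, b <- L) F (S z * a) b)); last by lin.
Qed.

(** Applying [lam] to the second leg in [sw_integral] recovers S x from the functional b |-> lam(x
    b); this is the source of nondegeneracy. *)
Lemma antipodeE x : S x = \sw_(a, b <- L) (lam (x * b) : K) *: a.
Proof.
rewrite -(sw_integral (F := fun a b => (lam b : K) *: a)); last by lin.
under eq_sw => a b do rewrite scalerAr.
rewrite -(sw_comp _ _ (f := fun z => S x * z)); last by lin.
by rewrite lint_integral lint_L scale1r mulr1.
Qed.

(** Applying [lam'] to the first leg in [sw_integral] recovers x from S x. *)
Lemma antipode_inj x : S x = 0 -> x = 0.
Proof.
move=> Sx0; have: \sw_(a, b <- L) (lam' (S x * a) : K) *: b = x.
  rewrite (sw_integral (F := fun a b => (lam' a : K) *: b)); last by lin.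
  under eq_sw => a b do rewrite scalerAr.
  rewrite -(sw_comp _ _ (f := fun z => x * z)); last by lin.
  by rewrite rint_integral rint_L scale1r mulr1.
move=> <-; rewrite Sx0; under eq_sw => a b do rewrite mul0r (lin0 llam') scale0r.
by apply: big1 => f _; rewrite scaler0.
Qed.

Lemma antipode_surj z : exists x, S x = z.
Proof. by apply: inj_surj => [|x]; [apply: lin_bundled | apply: antipode_inj]. Qed.

Lemma antipode2_surj z : exists x, phi x = z.
Proof.
have [x <-] := antipode_surj z; have [x' <-] := antipode_surj x.
by exists x'.
Qed.

Lemma lint_nondeg x : (forall b, lam (x * b) = 0) -> x = 0.
Proof.
move=> x0; apply: antipode_inj; rewrite antipodeE.
by apply: big1 => f _; rewrite x0 scale0r scaler0.
Qed.

(** Cyclicity of the trace. Thus phi is, up to convention, the Nakayama automorphism of the form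
    defined by [lam]. *)
Lemma lint_twist a b : lam (a * phi b) = lam (b * a).
Proof.
rewrite /lint; transitivity (ftr (fun x => b * (a * phi x))); last first.
  by apply: eq_ftr => x; rewrite mulrA.
rewrite (ftrC (f := fun x => b * x) (g := fun x => a * phi x)); [|by lin..].
by apply: eq_ftr => x; rewrite antipode2M mulrA.
Qed.

Lemma rint_twist a b : lam' (a * b) = lam' (phi b * a).
Proof.
rewrite /rint; transitivity (ftr (fun x => phi x * a * b)).
  by apply: eq_ftr => x; rewrite mulrA.
rewrite (ftrC (f := fun x => x * b) (g := fun x => phi x * a)); [|by lin..].
by apply: eq_ftr => x; rewrite antipode2M mulrA.
Qed.

(** Apply [lam'] to the first leg and [mu] to the second in [sw_integral]; each side collapses by
    one integral property. *)
Lemma left_integral_unique (mu : H -> K^o) : linear mu ->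
    (forall h, \sw_(a, b <- h) (mu b : K) *: a = (mu h : K) *: 1) ->
  forall x, mu x = (mu L : K) *: lam' (S x).
Proof.
move=> lmu imu x.
have := sw_integral (F := fun a b => (mu b : K) *: lam' a) x.
rewrite -[LHS](_ : lam' (S x * \sw_(a, b <- L) (mu b : K) *: a) = _); last first.
  rewrite (sw_comp _ _ (f := fun z => lam' (S x * z))); last by lin.
  by apply: eq_sw => a b; rewrite -scalerAr (linZ llam').
rewrite -[RHS](_ : mu (x * \sw_(a, b <- L) (lam' a : K) *: b) = _); last first.
  rewrite (sw_comp _ _ (f := fun z => mu (x * z))); last by lin.
  by apply: eq_sw => a b; rewrite -scalerAr (linZ lmu) [LHS]mulrC.
rewrite imu rint_integral rint_L scale1r mulr1 => <-; last by lin.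
by rewrite -scalerAr mulr1 (linZ llam').
Qed.

Lemma right_integral_unique (mu : H -> K^o) : linear mu ->
    (forall h, \sw_(a, b <- h) (mu a : K) *: b = (mu h : K) *: 1) ->
  forall x, mu (S x) = (mu L : K) *: lam x.
Proof.
move=> lmu imu x.
have := sw_integral (F := fun a b => (lam b : K) *: mu a) x.
rewrite -[LHS](_ : mu (S x * \sw_(a, b <- L) (lam b : K) *: a) = _); last first.
  rewrite (sw_comp _ _ (f := fun z => mu (S x * z))); last by lin.
  by apply: eq_sw => a b; rewrite -scalerAr (linZ lmu).
rewrite -[RHS](_ : lam (x * \sw_(a, b <- L) (mu a : K) *: b) = _); last first.
  rewrite (sw_comp _ _ (f := fun z => lam (x * z))); last by lin.
  by apply: eq_sw => a b; rewrite -scalerAr (linZ llam) [LHS]mulrC.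
rewrite imu lint_integral lint_L scale1r mulr1 => ->; last by lin.
by rewrite -scalerAr mulr1 (linZ llam).
Qed.

Lemma rint_antipode x : lam' (S x) = lam x.
Proof.
rewrite (@left_integral_unique lam llam (lint_integral D) x) lint_L.
by rewrite [RHS]mul1r.
Qed.

(* The distinguished grouplike element. *)
Definition dgl : H := \sw_(a, b <- L) (lam a : K) *: b.

(** The convolution of [lam] with any functional p on its right is again a left integral, hence a
    multiple of [lam]; the factor is its value at L, namely p(g) for g = [dgl]. *)
Lemma lint_dgl h : \sw_(a, b <- h) (lam a : K) *: b = (lam h : K) *: dgl.
Proof.
apply: functional_sep => p lp.
pose mu h : K^o := \sw_(a, b <- h) (p b : K) *: lam a.
have lmu : linear mu by rewrite /mu; lin.
have muE z : p (\sw_(a, b <- z) (lam a : K) *: b) = mu z.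
  rewrite (sw_comp _ _ (f := p)) //.
  by apply: eq_sw => a b; rewrite (linZ lp) [LHS]mulrC.
rewrite (linZ lp) !muE (@left_integral_unique mu) //; last first.
  move=> z; transitivity (\sw_(a, y <- z) \sw_(y1, y2 <- y)
     (p y2 : K) *: ((lam y1 : K) *: a)).
    apply: eq_sw => a y; rewrite (sw_comp _ _ (f := fun c : K^o => (c : K) *: a));
      last by lin.
    by apply: eq_sw => y1 y2; rewrite scalerA.
  rewrite -(@swA _ _ D _ (fun a y1 y2 => (p y2 : K) *: ((lam y1 : K) *: a)));
    [|lin..].
  under eq_sw => u y2.
    rewrite -(sw_comp _ _ (f := fun z => (p y2 : K) *: z)); last by lin.
    rewrite lint_integral; over.
  rewrite /mu (sw_comp _ _ (f := fun c : K^o => (c : K) *: 1)); last by lin.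
  by apply: eq_sw => y1 y2; rewrite scalerA.
by rewrite rint_antipode [LHS]mulrC.
Qed.

(** Expresses that [dgl] is grouplike. By coassociativity [lint_dgl] collapses the first two of
    three factors of L. *)
Lemma sw_dgl (W : lmodType K) (F : H -> H -> W) : bilin F ->
  sw D F dgl = F dgl dgl.
Proof.
move=> bF; rewrite {1}/dgl (sw_comp _ _ (f := fun z => sw D F z)); last by lin.
under eq_sw => a b.
  rewrite (linZ (lin_sw _ _)) -sw_scale.
  over.
rewrite -(@swA _ _ D _ (fun a b c => (lam a : K) *: F b c)); [|lin..].
transitivity (\sw_(u, c <- L) (lam u : K) *: F dgl c).
  apply: eq_sw => u c; have lF := lin_bl c bF.
  rewrite -(linZ lF) -lint_dgl (sw_comp _ _ _ lF).
  by apply: eq_sw => a b; rewrite (linZ lF).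
have lF := lin_br dgl bF; rewrite {3}/dgl (sw_comp _ _ _ lF).
by apply: eq_sw => a b; rewrite (linZ lF).
Qed.

Lemma counit_dgl : eps dgl = 1.
Proof.
have le : linear eps by apply: lin_bundled.
rewrite (sw_comp _ _ _ le) -lint_L.
rewrite -[RHS](sw_counitr D (f := lam)) //.
by apply: eq_sw => a b; rewrite (linZ le) [LHS]mulrC.
Qed.

Lemma mulSg : S dgl * dgl = 1.
Proof.
rewrite -(sw_dgl (F := fun a b => S a * b)); last by lin.
by rewrite (sw_antipodel D (f := id)) // counit_dgl scale1r.
Qed.

Lemma mulgS : dgl * S dgl = 1.
Proof.
rewrite -(sw_dgl (F := fun a b => a * S b)); last by lin.
by rewrite (sw_antipoder D (f := id)) // counit_dgl scale1r.
Qed.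

Lemma antipode2_dgl : phi dgl = dgl.
Proof.
by rewrite -[LHS]mul1r -mulgS -mulrA -antipodeM mulSg antipode1 mulr1.
Qed.

(** As g is grouplike, z |-> lam(z g) is a right integral; its value at L is 1, and right integrals
    are unique. *)
Lemma rintE x : lam' x = lam (x * dgl).
Proof.
have [y <-] := antipode_surj x; rewrite rint_antipode; symmetry.
rewrite (@right_integral_unique (fun z => lam (z * dgl))) /=.
- rewrite (intL _).2 counit_dgl scale1r lint_L.
  by rewrite [LHS]mul1r.
- by lin.
move=> h; transitivity (sw D (fun a b => (lam a : K) *: (b * S dgl)) (h * dgl)).
  rewrite swM; last by lin.
  apply: eq_sw => a b; rewrite (sw_dgl (F := fun c d =>
    (lam (a * c) : K) *: (b * d * S dgl))); last by lin.
  by rewrite -mulrA mulgS mulr1.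
under eq_sw => a b do rewrite scalerAl.
rewrite -(sw_comp _ _ (f := fun z => z * S dgl)); last by lin.
by rewrite lint_dgl -scalerAl mulgS.
Qed.

(** Radford's formula in the unimodular case. The twists of [lam] and [lam'] are compared through
    [rintE], and nondegeneracy of [lam] removes the functionals. *)
Lemma antipode4E b : phi (phi b) = S dgl * b * dgl.
Proof.
suff E : b * dgl = dgl * phi (phi b) by rewrite -mulrA E mulrA mulSg mul1r.
have [z zE] := antipode2_surj (b * dgl).
suff E : z = dgl * phi b by rewrite -zE E antipode2M antipode2_dgl.
apply/eqP; rewrite -subr_eq0; apply/eqP; apply: lint_nondeg => a.
rewrite mulrBl (linB llam); apply/eqP; rewrite subr_eq0; apply/eqP.
by rewrite -lint_twist zE mulrA -rintE rint_twist rintE -[in LHS]antipode2_dgl lint_twist mulrA.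
Qed.

(** Distinct grouplikes are linearly independent, so a linear relation among powers of g, which
    finite dimension supplies, forces two of them to coincide. *)
Lemma dgl_order : exists2 N, (0 < N)%N & dgl ^+ N = 1.
Proof.
pose X k := [seq dgl ^+ i | i <- iota 0 k].
have gX0 k : dgl ^+ k != 0.
  apply/eqP => gk0; have: S dgl ^+ k * dgl ^+ k = 1.
    elim: k {gk0} => [|k IH]; first by rewrite mul1r.
    by rewrite exprSr exprS mulrA -(mulrA _ (S dgl)) mulSg mulr1.
  by rewrite gk0 mulr0 => /esym/eqP; rewrite oner_eq0.
have grp k (W : lmodType K) (F : H -> H -> W) : bilin F ->
    sw D F (dgl ^+ k) = F (dgl ^+ k) (dgl ^+ k).
  elim: k F => [|k IH] F bF; first by rewrite sw1.
  rewrite exprSr swM // (IH (fun a b => \sw_(c, d <- dgl) F (a * c) (b * d))).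
    by rewrite (sw_dgl (F := fun c d => F (dgl ^+ k * c) (dgl ^+ k * d))) //; lin.
  by lin.
have exk : exists k, ~~ free (X k).
  exists (\dim {:H}).+1; apply/negP => /eqP fX.
  have := dimvS (subvf <<X (\dim {:H}).+1>>); rewrite fX.
  by rewrite size_map size_iota ltnn.
case: (ex_minnP exk) => [[|k] nfree kmin].
  by case/negP: nfree; rewrite /X /= nil_free.
have fX : free (X k) by apply: contraT => /kmin; rewrite ltnn.
have gk : dgl ^+ k \in <<X k>>%VS.
  apply: contraR nfree => gk; rewrite /X -addn1 iotaD map_cat /= add0n cats1.
  have -> : free (rcons (X k) (dgl ^+ k)) = free (dgl ^+ k :: X k).
    by apply: perm_free; rewrite perm_rcons.
  by rewrite free_cons gk.
pose b := in_tuple (X k).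
have szb : size b = k by rewrite /= size_map size_iota.
have bE (i : 'I_(size (X k))) : b`_i = dgl ^+ i.
  have ik : (i < k)%N by case: i => /= i; rewrite size_map size_iota.
  by rewrite /= (nth_map 0%N) ?size_iota // nth_iota.
have gE := @coord_span _ _ _ b _ gk; set a := fun i => coord b i (dgl ^+ k).
(* The i-th coordinate functional on the first leg of Delta(g^k), computed from g^k itself and from
   its expansion in lower powers. *)
have aE i : (a i : K) *: dgl ^+ k = (a i : K) *: dgl ^+ i.
  pose c : H -> K^o := coord b i; have lc : linear c by apply: lin_bundled.
  have bF : bilin (fun x z : H => (c x : K) *: z) by lin.
  have cb (j : 'I_(size (X k))) : c (dgl ^+ j) = (i == j)%:R.
    by rewrite -bE /c coord_free // eq_sym.
  have := grp k H _ bF; rewrite {1}gE (lin_sum (lin_sw _ _)) => eqk.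
  rewrite -[LHS]eqk (bigD1 i) //= [X in _ + X]big1 ?addr0.
    by rewrite (linZ (lin_sw _ _)) bE grp // cb eqxx scale1r.
  move=> j ji; rewrite (linZ (lin_sw _ _)) bE grp // cb eq_sym (negPf ji).
  by rewrite scale0r scaler0.
have [i ai0] : exists i, a i != 0.
  apply/existsP; apply: contraR (gX0 k); rewrite negb_exists => /forallP a0.
  rewrite gE big1 // => i _; have /eqP := negbNE (a0 i).
  by rewrite /a => ->; rewrite scale0r.
have ik : (i < k)%N by case: (i) => /= j; rewrite size_map size_iota.
exists (k - i)%N; first by rewrite subn_gt0.
have := scalerI ai0 (aE i); rewrite -{1}(subnK (ltnW ik)) exprD => eqg.
have gS : dgl ^+ i * S dgl ^+ i = 1.
  elim: {+}(nat_of_ord i) => [|j IH]; first by rewrite mul1r.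
  by rewrite exprSr exprS mulrA -(mulrA _ dgl) mulgS mulr1.
by rewrite -[LHS]mulr1 -gS mulrA eqg gS.
Qed.

Lemma iter_antipode4 k b : iter k.*2 phi b = S dgl ^+ k * b * dgl ^+ k.
Proof.
elim: k => [|k IH]; first by rewrite mul1r mulr1.
by rewrite doubleS !iterS IH antipode4E exprS exprSr !mulrA.
Qed.

Lemma antipode2_order : exists2 M, (0 < M)%N & forall b, iter M phi b = b.
Proof.
have [N N0 gN] := dgl_order; exists N.*2; first by rewrite double_gt0.
move=> b; rewrite iter_antipode4 gN mulr1.
suff -> : S dgl ^+ N = 1 by rewrite mul1r.
suff E k : S dgl ^+ k * dgl ^+ k = 1 by rewrite -(E N) gN mulr1.
elim: k => [|k IH]; first by rewrite mul1r.
by rewrite exprSr exprS mulrA -(mulrA _ (S dgl)) mulSg mulr1.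
Qed.

(** [lam 1] is Tr(phi), and [lint_dgl] at 1 reads lam(1) 1 = lam(1) g, so g = 1 in the formula for
    S^4. *)
Lemma antipode2_invol : ftr phi != 0 -> forall b, phi (phi b) = b.
Proof.
move=> t0 b; rewrite antipode4E.
suff -> : dgl = 1 by rewrite antipode1 mul1r mulr1.
have lam1 : lam 1 != 0 by rewrite /lint (eq_ftr (g := phi)) // => x; rewrite mul1r.
have := lint_dgl 1; rewrite sw1; last by lin.
by move/(scalerI lam1).
Qed.
End Integral.
End IntegralTheory.

(** * Semisimple algebras *)

Section SemisimpleAlgebra.
Variables (K : closedFieldType) (H : falgType K).
Hypothesis charK : [pchar K] =i pred0.
Hypothesis ssH : semisimple H.

Local Notation chreg := (@regchar K H).

Lemma natK_eq0 n : (n%:R == 0 :> K) = (n == 0)%N.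
Proof. by move/pcharf0P: charK => ->. Qed.

Lemma natK_inj p q : p%:R = q%:R :> K -> p = q.
Proof.
wlog le_pq : p q / (p <= q)%N => [th|].
  by have [/th|/ltnW/th th' /esym/th' ->] := leqP p q.
move/eqP; rewrite eq_sym -subr_eq0 -natrB // natK_eq0 subn_eq0 => le_qp.
by apply/eqP; rewrite eqn_leq le_pq.
Qed.

Lemma regchar_idem (e : H) : e * e = e -> exists2 r : nat, chreg e = r%:R & r = 0%N -> e = 0.
Proof.
move=> ee; have [||W [trE eW _]] := @ftr_idem K H (fun x => e * x).
- by lin.
- by move=> x; rewrite mulrA ee.
exists (\dim W) => // /eqP; rewrite dimv_eq0 => /eqP W0.
by have := eW 1; rewrite W0 memv0 mulr1 => /eqP.
Qed.

Lemma regchar_sqr0 (x : H) : x * x = 0 -> chreg x = 0.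
Proof. by move=> xx; apply: ftr_sqr0 => [|z]; [lin | rewrite mulrA xx mul0r]. Qed.

(** [e] is the component of 1 in the left ideal H a along a complementary left ideal J. For z in H
    a, the product of z with the J-component of 1 lies in both ideals. *)
Lemma ideal_idempotent (a : H) : exists2 e,
  exists x, e = x * a & forall x, x * a * e = x * a.
Proof.
have la : linear (fun x => x * a) by lin.
have [g gE] := lin_bundle la; pose I := limg (linfun g).
have IP x : reflect (exists y, x = y * a) (x \in I).
  apply: (iffP memv_imgP) => [[y _ ->]|[y ->]]; exists y; rewrite ?memvf // lfunE /= gE //.
have [|J [JI IJ1 IJ0]] := ssH (I := I).
  by move=> b x /IP[y ->]; apply/IP; exists (b * y); rewrite mulrA.
have : (1 : H) \in (I + J)%VS by rewrite IJ1 memvf.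
case/memv_addP => e eI [f fJ efE]; exists e; first exact/IP.
move=> x; set z := x * a; have zI : z \in I by apply/IP; exists x.
have zf : z * f \in (I :&: J)%VS.
  rewrite memv_cap JI // andbT.
  have -> : z * f = z - z * e by rewrite -{2}[z]mulr1 efE mulrDr addrAC subrr add0r.
  by apply: rpredB => //; have /IP[y ->] := eI; apply/IP; exists (z * y); rewrite mulrA.
move: zf; rewrite IJ0 memv0 => /eqP zf.
by rewrite -[RHS]mulr1 efE mulrDr zf addr0.
Qed.

(** The idempotent generating H a has the form x a, so its rank chreg(x a) is 0; it vanishes, and a
    with it. *)
Lemma regchar_nondeg (a : H) : (forall b, chreg (a * b) = 0) -> a = 0.
Proof.
move=> a0; have [e [x eE] ea] := ideal_idempotent a.
have ee : e * e = e by rewrite {1}eE ea eE.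
have [r rE r0] := regchar_idem ee.
have e0 : e = 0.
  apply: r0; apply/eqP; rewrite -natK_eq0 -rE eE; apply/eqP.
  by rewrite regcharC a0.
by have := ea 1; rewrite e0 mulr0 mul1r => <-.
Qed.

Lemma regchar_inj a b : (forall c, chreg (a * c) = chreg (b * c)) -> a = b.
Proof.
move=> ab; apply/eqP; rewrite -subr_eq0; apply/eqP; apply: regchar_nondeg => c.
by rewrite mulrBl (linB (@lin_regchar K H)) ab subrr.
Qed.

(** The Gram map [f] of the trace form is injective by nondegeneracy, hence surjective. *)
Lemma regchar_represents (q : H -> K^o) : linear q ->
  exists u, forall a, q a = chreg (u * a).
Proof.
move=> lq; have lc := @lin_regchar K H; pose e := vbasis {:H}.
pose f u := \sum_(i < \dim {:H}) (chreg (u * e`_i) : K) *: e`_i.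
have fe : free e := basis_free (vbasisP _).
have [||u uE] := @inj_surj K H f _ _ (\sum_(i < \dim {:H}) (q e`_i : K) *: e`_i).
- by apply: lin_bigsum => i; lin.
- move=> u u0; apply: regchar_nondeg => b; rewrite (coord_vbasis (memvf b)).
  rewrite mulr_sumr (lin_sum lc) big1 // => i _.
  by rewrite -scalerAr (linZ lc) -(coord_sum_free (fun j => chreg (u * e`_j)) i fe)
    -/(f u) u0 linear0 scaler0.
exists u => a; rewrite (coord_vbasis (memvf a)) mulr_sumr (lin_sum lc) (lin_sum lq).
apply: eq_bigr => i _; rewrite (linZ lq) -scalerAr (linZ lc); congr (_ *: _).
rewrite -[LHS](coord_sum_free (fun j => q e`_j) i fe) -uE.
exact: (coord_sum_free (fun j => chreg (u * e`_j)) i fe).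
Qed.

(** The left and right regular characters agree: passing from the basis to its dual family [u] under
    the trace form exchanges the two multiplications. *)
Lemma ftr_mulr b : ftr (fun x : H => x * b) = chreg b.
Proof.
have lc := @lin_regchar K H; pose e := vbasis {:H}.
pose cd (i : 'I_(\dim {:H})) : H -> K^o := coord e i.
have lcd i : linear (cd i) by apply: lin_bundled.
have [u uE] : exists u : 'I_(\dim {:H}) -> H, forall i a, cd i a = chreg (u i * a).
  have /fin_all_exists[u uE] := fun i => regchar_represents (lcd i).
  by exists u.
rewrite /chreg [RHS](@ftr_family K H _ u (fun i x => chreg (e`_i * x))).
- rewrite /ftr; apply: eq_bigr => i _; rewrite -/e -/(cd i _) uE.
  by rewrite [in RHS]mulrA [RHS]regcharC.
- by move=> i; lin.
- move=> x; apply: regchar_inj => c; rewrite (coord_vbasis (memvf c)).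
  rewrite !mulr_sumr !(lin_sum lc); apply: eq_bigr => i _.
  rewrite -!scalerAr !(linZ lc); congr (_ *: _).
  rewrite mulr_suml (lin_sum lc) (bigD1 i) //= big1 ?addr0.
    rewrite -scalerAl (linZ lc) -/e -uE /cd coord_free ?eqxx ?(basis_free (vbasisP _)) //.
    by rewrite [RHS]mulr1 regcharC.
  move=> j ji; rewrite -scalerAl (linZ lc) -/e -uE /cd.
  rewrite coord_free ?(basis_free (vbasisP _)) //.
  by rewrite eq_sym (negPf ji) scaler0.
- by lin.
Qed.

Definition central (c : H) := forall a, c * a = a * c.

(** At first [e] is only a right identity of H d. Its defects [N w] as a left identity form a right
    ideal, and N w e = N w makes them square to zero; so the trace form kills them and they
    vanish. *)
Lemma central_ideal_idempotent d : central d ->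
  exists e, [/\ central e, exists y, e = y * d & d * e = d].
Proof.
move=> cd; have [e [y eE] ed] := ideal_idempotent d.
pose N w := e * (w * d) - w * d.
have Nb x b : N x * b = N (x * b).
  by rewrite /N mulrBl -!mulrA cd.
have Ne x : N x * e = N x by rewrite /N mulrBl -mulrA ed.
have ez x : e * (x * d) = x * d.
  apply/eqP; rewrite -subr_eq0 -/(N x); apply/eqP; apply: regchar_nondeg => b.
  rewrite Nb; apply: regchar_sqr0.
  by rewrite [X in _ * X]/N mulrBr [N _ * (e * _)]mulrA Ne subrr.
exists e; split; last by rewrite -[d in LHS]mul1r ed mul1r.
  move=> b; have eb : e * b = y * b * d by rewrite eE -mulrA cd mulrA.
  have be : b * e = b * y * d by rewrite eE mulrA.
  transitivity (e * b * e); first by rewrite eb ed.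
  by rewrite -mulrA be ez.
by exists y.
Qed.

End SemisimpleAlgebra.

(* map_resultant is only stated for morphisms out of polynomial rings. *)
Lemma resultant_map (aR rR : nzRingType) (f : {rmorphism aR -> rR}) p q :
    f (lead_coef p) != 0 -> f (lead_coef q) != 0 ->
  f (resultant p q) = resultant (map_poly f p) (map_poly f q).
Proof.
move=> nz_fp nz_fq; rewrite /resultant /Sylvester_mx !size_map_poly_id0 //.
rewrite -det_map_mx /= map_col_mx; congr (\det (col_mx _ _));
  by apply: map_lin1_mx => v; rewrite map_poly_rV rmorphM /= map_rVpoly.
Qed.

(** * Positivity in cyclotomic fields and traces of inner automorphisms *)

Section Positivity.
Variable K : closedFieldType.
Hypothesis charK : [pchar K] =i pred0.

Lemma intK_eq0 (c : int) : (c%:~R == 0 :> K) = (c == 0).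
Proof.
by case: c => n; rewrite ?NegzE ?rmorphN ?oppr_eq0 /= ?natz -?pmulrn natK_eq0.
Qed.

(** Passes from K to the complex algebraic numbers through the resultant of Q and X^M - 1: it is an
    integer that vanishes in K, hence is 0. *)
Lemma common_root_algC (z : K) M (Q : {poly int}) : (0 < M)%N -> z ^+ M = 1 ->
    (map_poly intr Q).[z] = 0 ->
  exists2 w : algC, w ^+ M = 1 & (map_poly intr Q).[w] = 0.
Proof.
move=> M0 zM Qz; have [sQ|sQ] := leqP (size Q) 1.
  (* A constant Q with a root in K is 0, and w = 1 serves; the resultant argument takes over in
     positive degree. *)
  move: Qz; rewrite (size1_polyC sQ); move: Q`_0 => c; rewrite map_polyC hornerC /= => /eqP.
  rewrite intK_eq0 => /eqP ->; exists 1; first by rewrite expr1n.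
  by rewrite map_polyC hornerC.
pose q : {poly int} := 'X^M - 1.
have mapq (R : nzRingType) : map_poly intr q = 'X^M - 1 :> {poly R}.
  by rewrite /q rmorphB /= map_polyXn rmorph1.
have sq : (1 < size q)%N by rewrite size_XnsubC.
have [[a b] /= _ rE] := resultant_in_ideal sQ sq.
have r0 : resultant Q q = 0.
  apply/eqP; rewrite -intK_eq0; apply/eqP.
  have := congr1 (fun p => (map_poly intr p : {poly K}).[z]) rE.
  rewrite map_polyC hornerC rmorphD !rmorphM /= mapq !hornerE Qz zM.
  by rewrite subrr !mulr0 addr0.
have : resultant (map_poly intr Q) ('X^M - 1 : {poly algC}) = 0.
  rewrite -mapq -(resultant_map (f := intr)) ?r0 ?rmorph0 //;
  by rewrite intr_eq0 lead_coef_eq0 -size_poly_gt0 ltnW.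
move/eqP; rewrite resultant_eq0 => sg.
have [|w] := @closed_rootP algC (gcdp (map_poly intr Q) ('X^M - 1)) _.
  by rewrite gtn_eqF.
rewrite root_gcd => /andP[/rootP Qw /rootP]; rewrite !hornerE => /eqP.
by rewrite subr_eq0 => /eqP wM; exists w.
Qed.

Lemma closed_prim_root M : (0 < M)%N -> exists z : K, M.-primitive_root z.
Proof.
move=> M0; have [r rE] := closed_field_poly_normal ('X^M - 1 : {poly K}).
have mon : lead_coef ('X^M - 1 : {poly K}) = 1 by apply/eqP/monicXnsubC.
rewrite mon scale1r in rE.
have ur : uniq r.
  by rewrite -separable_prod_XsubC -rE separable_Xn_sub_1 // natK_eq0 // -lt0n.
have sr : size r = M.
  by have := congr1 (fun p : {poly K} => size p) rE; rewrite size_prod_XsubC size_XnsubC // => -[].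
have /hasP[z _ zP] : has M.-primitive_root r.
  apply: has_prim_root => //; last by rewrite sr.
  by apply/allP => x xr; rewrite /root_of_unity rE root_prod_XsubC.
by exists z.
Qed.

Variables (z : K) (M : nat).
Hypothesis M0 : (0 < M)%N.
Hypothesis zprim : M.-primitive_root z.

(* Nonnegativity of an element of Q(z), z a primitive M-th root of unity,
   under every embedding of Q(z) into the complex numbers. *)
Definition nonneg_cyclotomic (a : K) := exists c (Q : {poly int}),
  [/\ (0 < c)%N, c%:R * a = (map_poly intr Q).[z]
    & forall w : algC, w ^+ M = 1 -> 0 <= (map_poly intr Q).[w]].

Lemma nonneg_cyclotomic0 : nonneg_cyclotomic 0.
Proof.
by exists 1%N, 0; split=> [||w _] //; rewrite rmorph0 horner0 // mulr0.
Qed.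

Lemma nonneg_cyclotomicD a b :
  nonneg_cyclotomic a -> nonneg_cyclotomic b -> nonneg_cyclotomic (a + b).
Proof.
move=> [c [P [c0 aE P0]]] [d [Q [d0 bE Q0]]].
exists (c * d)%N, (P *+ d + Q *+ c); split=> [||w wM]; first by rewrite muln_gt0 c0.
  rewrite rmorphD !rmorphMn /= hornerD !hornerMn -aE -bE natrM mulrDr.
  congr (_ + _); first by rewrite -[RHS]mulr_natr mulrAC.
  by rewrite -[RHS]mulr_natl mulrA.
by rewrite rmorphD !rmorphMn /= hornerD !hornerMn addr_ge0 // mulrn_wge0 ?P0 ?Q0.
Qed.

(** If 1 + a = 0, then Q + c vanishes at z, hence at some complex M-th root of unity, where its
    value is at least c > 0. *)
Lemma nonneg_cyclotomic_1D a : nonneg_cyclotomic a -> 1 + a != 0.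
Proof.
move=> [c [Q [c0 aE Q0]]]; apply/eqP => a0.
have [||w wM] := @common_root_algC z M (Q + c%:R) M0.
- exact: prim_expr_order.
- rewrite rmorphD rmorph_nat hornerD -aE -polyC_natr hornerC.
  by rewrite -{2}[c%:R]mulr1 -mulrDr addrC a0 mulr0.
rewrite rmorphD rmorph_nat hornerD -polyC_natr hornerC => Qw.
have : 0 < (map_poly intr Q).[w] + c%:R by rewrite ltr_wpDl ?Q0 // ltr0n.
by rewrite Qw ltxx.
Qed.

Section Algebra.
Variable H : falgType K.
Hypothesis ssH : semisimple H.
Local Notation chreg := (@regchar K H).
Let lc := @lin_regchar K H.

Lemma sum_prim_root (j : nat) : \sum_(i < M) z^-1 ^+ (i * j) = (M %| j)%N%:R *+ M.
Proof.
have zj i : z^-1 ^+ (i * j) = (z^-1 ^+ j) ^+ i by rewrite mulnC exprM.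
under eq_bigr => i _ do rewrite zj.
have : z^-1 ^+ j ^+ M = 1.
  by rewrite -exprM mulnC exprM exprVn (prim_expr_order zprim) invr1 expr1n.
move=> zM1; have [Mj|nMj] := boolP (M %| j)%N.
  have -> : z^-1 ^+ j = 1.
    by rewrite exprVn; move: Mj; rewrite (prim_order_dvd zprim) => /eqP ->; rewrite invr1.
  by under eq_bigr => i _ do rewrite expr1n; rewrite sumr_const card_ord.
have := subrX1 (z^-1 ^+ j) M; rewrite zM1 subrr => /esym/eqP.
rewrite mulf_eq0 subr_eq0 => /orP[/eqP zj1|/eqP -> //]; last by rewrite mul0rn.
by case/negP: nMj; rewrite (prim_order_dvd zprim) -invr_eq1 -exprVn zj1.
Qed.

(** On eH, multiplication by v is diagonalizable with powers of z as eigenvalues; [m i] is the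
    multiplicity of z^i. *)
Lemma trace_powers (e v : H) : e * e = e -> e * v = v -> v * e = v -> v ^+ M = e ->
  exists m : nat -> nat, forall k, (0 < k)%N ->
    chreg (v ^+ k) = \sum_(i < M) (m i)%:R * (z ^+ k) ^+ i.
Proof.
move=> ee ev ve vM.
have MK : M%:R != 0 :> K by rewrite natK_eq0 // -lt0n.
have z0 : z != 0 by rewrite (prim_root_eq0 zprim) -lt0n.
(* Discrete Fourier projections onto the eigenspaces of v. The factor [e] makes the term j = 0 equal
   to e instead of 1. *)
pose f i j : H := (z^-1 ^+ (i * j)) *: (v ^+ j * e).
pose p i := (M%:R^-1 : K) *: \sum_(j < M) f i j.
have fM i : f i M = f i 0%N.
  by rewrite /f mulnC exprM exprVn (prim_expr_order zprim) invr1 expr1n muln0 vM ee mul1r.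
have vp i : v * p i = z ^+ i *: p i.
  rewrite /p -scalerAr !scalerA mulrC -scalerA; congr (_ *: _).
  rewrite mulr_sumr.
  have -> : \sum_(j < M) f i j = \sum_(j < M) f i j.+1.
    apply: (addIr (f i M)); transitivity (\sum_(j < M.+1) f i j).
      by rewrite big_ord_recr.
    by rewrite big_ord_recl fM addrC; congr (_ + _).
  rewrite scaler_sumr; apply: eq_bigr => j _; rewrite /f -scalerAr mulrA -exprS scalerA.
  by congr (_ *: _); rewrite mulnS exprD mulrA -exprMn divff // expr1n mul1r.
have vkp k i : v ^+ k * p i = (z ^+ k) ^+ i *: p i.
  elim: k => [|k IH]; first by rewrite expr1n mul1r scale1r.
  rewrite exprSr -mulrA vp -scalerAr IH scalerA [in RHS]exprSr exprMn mulrC.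
  by congr (_ *: _).
have evk k : e * v ^+ k = v ^+ k * e.
  by elim: k => [|k IH]; rewrite ?mulr1 ?mul1r // exprSr mulrA IH -mulrA ev -mulrA ve.
have ep i : e * p i = p i.
  rewrite /p -scalerAr mulr_sumr; congr (_ *: _); apply: eq_bigr => j _.
  by rewrite /f -scalerAr mulrA evk -mulrA ee.
have pp i : p i * p i = p i.
  have zz j : z^-1 ^+ (i * j) * (z ^+ j) ^+ i = 1.
    by rewrite -exprM (mulnC j) -exprMn mulVf // expr1n.
  rewrite {1}/p -scalerAl mulr_suml.
  under eq_bigr => j _.
    rewrite /f -scalerAl -mulrA ep vkp scalerA zz scale1r.
    over.
  by rewrite sumr_const card_ord -scaler_nat scalerA mulVf // scale1r.
have psum : \sum_(i < M) p i = e.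
  rewrite /p -scaler_sumr exchange_big /= (bigD1 (Ordinal M0)) //= [X in _ + X]big1.
    rewrite addr0 /f -scaler_suml; under eq_bigr => i _ do rewrite muln0.
    by rewrite sumr_const card_ord mul1r scalerA mulVf // scale1r.
  move=> j j0; rewrite /f -scaler_suml sum_prim_root.
  rewrite [(M %| j)%N](_ : _ = false) ?mul0rn ?scale0r //.
  by apply/negP => /dvdn_leq; rewrite lt0n => /(_ j0); rewrite leqNgt ltn_ord.
have [m mE] : exists m : nat -> nat, forall i, chreg (p i) = (m i)%:R.
  have mex i : exists r : nat, chreg (p i) == r%:R.
    by have [r -> _] := regchar_idem (pp i); exists r.
  by exists (fun i => xchoose (mex i)) => i; apply/eqP/(xchooseP (mex i)).
(* Positivity of k matters: v^0 is 1 and not e. *)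
exists m => k k0; have -> : v ^+ k = v ^+ k * e.
  by case: k k0 => // k _; rewrite exprSr -mulrA ve.
rewrite -psum mulr_sumr (lin_sum lc); apply: eq_bigr => i _.
by rewrite vkp (linZ lc) mE [LHS]mulrC.
Qed.

(** With P the generating polynomial of the multiplicities, the product is P(z) P(z^-1), which at a
    complex root of unity w becomes |P(w)|^2. *)
Lemma nonneg_trace_inverse (e v : H) : e * e = e -> e * v = v -> v * e = v ->
  v ^+ M = e -> exists Q : {poly int},
  chreg v * chreg (v ^+ (M + M.-1)) = (map_poly intr Q).[z] /\
  forall w : algC, w ^+ M = 1 -> 0 <= (map_poly intr Q).[w].
Proof.
move=> ee ev ve vM; have [m mE] := trace_powers ee ev ve vM.
(* v^N is the inverse of v in eHe; the extra M keeps the exponent positive when M = 1. *)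
set N := (M + M.-1)%N; pose P : {poly int} := \sum_(i < M) 'X^i *+ m i.
have PE (R : comNzRingType) (x : R) :
    (map_poly intr P).[x] = \sum_(i < M) (m i)%:R * x ^+ i.
  rewrite rmorph_sum horner_sum; apply: eq_bigr => i _.
  by rewrite rmorphMn /= map_polyXn hornerMn hornerXn mulr_natl.
have PNE (R : comNzRingType) (x : R) :
    (map_poly intr (P \Po 'X^N)).[x] = (map_poly intr P).[x ^+ N].
  by rewrite map_comp_poly map_polyXn horner_comp !hornerE.
exists (P * (P \Po 'X^N)); split=> [|w wM].
  rewrite rmorphM hornerM PNE !PE -{1}[v]expr1 !mE //.
  by rewrite addn_gt0 M0.
rewrite rmorphM hornerM PNE.
have wN : w ^+ N = w^*%C.
  have w0 : w != 0 by apply: contraPneq wM => ->; rewrite expr0n gtn_eqF // => /esym/eqP; rewrite oner_eq0.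
  have w1 : `|w| = 1.
    by apply/eqP; rewrite -(@pexpr_eq1 _ _ M) // -normrX wM normr1.
  rewrite /N exprD wM mul1r.
  by apply: (mulfI w0); rewrite -exprS prednK // wM -normCK w1 expr1n.
suff -> : (map_poly intr P).[w ^+ N] = ((map_poly intr P).[w])^*%C.
  by rewrite -normCK exprn_ge0.
rewrite wN !PE rmorph_sum; apply: eq_bigr => i _.
by rewrite rmorphM rmorph_nat rmorphXn.
Qed.

(** If c has eigenvalue a on eH with eigenvector y, the central element (c - a) e kills y. Either it
    is 0, or the idempotent generating its ideal lies properly below e. *)
Lemma central_split (c e : H) : central c -> central e -> e * e = e -> e != 0 ->
  (exists s : K, c * e = s *: e) \/
  (exists e', [/\ central e', e' * e' = e', e' * e = e', e' != 0 & e' != e]).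
Proof.
move=> cc ce ee e0.
have [||W [_ eW We]] := @ftr_idem K H (fun x => e * x).
- by lin.
- by move=> x; rewrite mulrA ee.
have [||a [x [x0 xE]]] := @closed_eigenvector K (subvs_of W)
    (fun x => vsproj W (c * vsval x)).
- by move=> a x y; rewrite linearP /= mulrDr -scalerAr linearP.
- rewrite dim_subvs lt0n dimv_eq0; apply: contra e0 => /eqP W0.
  by have := eW 1; rewrite W0 memv0 mulr1.
set y := vsval x; have yW : y \in W by apply: subvsP.
have ey : e * y = y by apply: We.
have cy : c * y = a *: y.
  rewrite -[RHS](linZ (f := vsval)) // -xE vsprojK //.
  by rewrite -/y -ey mulrA cc -mulrA eW.
have y0 : y != 0 by apply: contra x0 => /eqP y0; apply/eqP/val_inj; rewrite linear0.
pose d := c * e - a *: e.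
have cd : central d.
  by move=> b; rewrite mulrBl mulrBr -scalerAl -scalerAr -(mulrA c) (ce b) mulrA (cc b) -mulrA.
have dy : d * y = 0 by rewrite mulrBl -mulrA ey cy -scalerAl ey subrr.
have [e' [ce' [b e'E] de']] := central_ideal_idempotent charK ssH cd.
have de : d * e = d by rewrite mulrBl -mulrA ee -scalerAl ee.
have [e'0|e'0] := eqVneq e' 0.
  left; exists a; apply/eqP; rewrite -subr_eq0 -/d.
  by rewrite -de' e'0 mulr0.
right; exists e'; split=> //.
- by rewrite {1}e'E -mulrA de' -e'E.
- by rewrite e'E -mulrA de.
apply/eqP => e'e; case/eqP: y0.
by rewrite -ey -e'e e'E -mulrA dy mulr0.
Qed.

Lemma closed_root (a : K) n : (0 < n)%N -> exists b, b ^+ n = a.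
Proof.
move=> n0; have [|b /rootP] := @closed_rootP K ('X^n - a%:P) _.
  by rewrite size_XnsubC //; case: n n0.
by rewrite !hornerE => /eqP; rewrite subr_eq0 => /eqP; exists b.
Qed.

(* The last hypothesis holds for every central zb when e is minimal; it makes
   the bilinear form Tr(t |-> e a t b) have rank one. *)
Lemma inner_trace_simple (a b e : H) (s : K) (zb : H) :
    (forall x, chreg (zb * x) = ftr (fun t => x * t * b)) ->
    central e -> zb * e = s *: e ->
  chreg e * ftr (fun t => e * a * t * b) = chreg (e * a) * chreg (e * b).
Proof.
move=> zbE ce zs.
have E x : ftr (fun t => e * x * t * b) = s * chreg (e * x).
  by rewrite -zbE mulrA zs -scalerAl (linZ lc).
have sE : s * chreg e = chreg (e * b).
  rewrite -[e in LHS]mulr1 -E -[RHS](ftr_mulr charK ssH); apply: eq_ftr => t.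
  by rewrite mulr1 ce mulrA.
by rewrite E -sE mulrCA [RHS]mulrCA; congr (_ * _); rewrite mulrC.
Qed.

Section Inner.
Variables u w : H.
Hypotheses (uw : u * w = 1) (wu : w * u = 1) (uM : central (u ^+ M)).

(** Induction on the rank of e stands in for a decomposition into minimal central idempotents:
    either e splits, or the two central elements that matter, [zb] and u^M, are scalar on eH. *)
Lemma nonneg_inner_trace e : central e -> e * e = e ->
  nonneg_cyclotomic (ftr (fun x => e * (u * x * w))).
Proof.
move=> ce ee; have [k kE _] := regchar_idem ee; move: k kE ce ee.
move=> k; have [n] := ubnP k; elim: n e k => // n IH e k kn kE ce ee.
have [e0|e0] := eqVneq e 0.
  rewrite (eq_ftr (g := fun=> 0)) /ftr ?big1 => [|i _|x]; first exact: nonneg_cyclotomic0.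
    by rewrite linear0.
  by rewrite e0 mul0r.
have idem_gt0 f : f * f = f -> f != 0 -> exists2 r, chreg f = r%:R & (0 < r)%N.
  move=> ff f0; have [r rE r0] := regchar_idem ff; exists r => //.
  by rewrite lt0n; apply: contra f0 => /eqP /r0 ->.
have split e' : central e' -> e' * e' = e' -> e' * e = e' -> e' != 0 -> e' != e ->
    nonneg_cyclotomic (ftr (fun x => e * (u * x * w))).
  move=> ce' ee' e'e e'0 e'ne; pose f := e - e'.
  have ff : f * f = f.
    by rewrite /f mulrBl !mulrBr ee ee' -(ce' e) e'e subrr subr0.
  have f0 : f != 0 by rewrite subr_eq0 eq_sym.
  have cf : central f by move=> b; rewrite /f mulrBl mulrBr ce ce'.
  have [r1 r1E r1p] := idem_gt0 _ ee' e'0; have [r2 r2E r2p] := idem_gt0 _ ff f0.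
  have kr : k = (r1 + r2)%N.
    apply: (natK_inj charK).
    by rewrite natrD -r1E -r2E -kE -(linD lc) /f addrC subrK.
  rewrite (eq_ftr (g := fun x => e' * (u * x * w) + f * (u * x * w))); last first.
    by move=> x; rewrite -mulrDl /f addrC subrK.
  rewrite ftrD; apply: nonneg_cyclotomicD.
    by apply: (IH _ r1) => //; rewrite -ltnS (leq_trans _ kn) // kr ltnS -addn1 leq_add2l.
  by apply: (IH _ r2) => //; rewrite -ltnS (leq_trans _ kn) // kr ltnS -add1n leq_add2r.
(* The trace form represents x |-> Tr(t |-> x t w) by [zb], and cyclicity makes [zb] central. *)
have [zb zbE] : exists zb, forall x, chreg (zb * x) = ftr (fun t => x * t * w).
  have [|zb zbE] := @regchar_represents K H charK ssH (fun x => ftr (fun t => x * t * w)).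
    by lin.
  by exists zb => x; rewrite -zbE.
have czb : central zb.
  move=> x; apply: (regchar_inj charK ssH) => y.
  rewrite -mulrA zbE -mulrA regcharC -mulrA zbE.
  transitivity (ftr (fun t => x * (y * t * w))).
    by apply: eq_ftr => t; rewrite !mulrA.
  rewrite (ftrC (f := fun t => x * t) (g := fun t => y * t * w)); [|by lin..].
  by apply: eq_ftr => t; rewrite !mulrA.
case: (central_split czb ce ee e0) => [[s zs]|[e' []]]; last exact: split.
case: (central_split uM ce ee e0) => [[s' us]|[e' []]]; last exact: split.
(* Dividing e u by an M-th root of the scalar of u^M gives v with v^M = e. *)
have [r0 r0E] := closed_root s' M0.
have wM : w ^+ M * u ^+ M = 1.
  elim: {+}M => [|j IHj]; first by rewrite mul1r.
  by rewrite exprSr exprS mulrA -(mulrA _ w) wu mulr1.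
have r00 : r0 != 0.
  apply: contraNneq e0 => r00; apply/eqP.
  rewrite -[e]mul1r -wM -mulrA us -r0E r00 expr0n gtn_eqF //.
  by rewrite scale0r mulr0.
pose v := r0^-1 *: (e * u); pose v' := r0 *: (e * w).
have ev : e * v = v by rewrite /v -scalerAr mulrA ee.
have ve : v * e = v by rewrite -ce.
have vk j : v ^+ j * e = r0 ^- j *: (u ^+ j * e).
  elim: j => [|j IHj]; first by rewrite invr1 scale1r.
  rewrite exprSr -mulrA ve -[X in _ * X]ev mulrA IHj -scalerAl -mulrA ev /v -scalerAr scalerA.
  by rewrite (ce u) mulrA -exprSr [in RHS]exprS invfM mulrC.
have vM : v ^+ M = e.
  have -> : v ^+ M = v ^+ M * e by rewrite -(prednK M0) exprSr -mulrA ve.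
  rewrite vk us -r0E scalerA mulVf ?scale1r //.
  by rewrite expf_neq0.
have vv' : v * v' = e.
  rewrite /v /v' -scalerAl -scalerAr scalerA mulVf // scale1r.
  by rewrite (ce u) -mulrA (mulrA e) ee ce mulrA uw mul1r.
have v'E : v' = v ^+ (M + M.-1).
  have ev' : e * v' = v' by rewrite /v' -scalerAr mulrA ee.
  rewrite exprD vM -[LHS]ev' -{1}vM.
  by rewrite -(prednK M0) exprSr -mulrA vv' -ce /=.
have [Q [QE Q0]] := nonneg_trace_inverse ee ev ve vM.
(* The denominator k = chreg(e) comes from the rank-one identity [inner_trace_simple]. *)
exists k, Q; split=> //.
  have [r rE rp] := idem_gt0 _ ee e0; rewrite lt0n; apply: contraTneq rp => k0.
  by have /eqP := rE; rewrite kE k0 eq_sym natK_eq0 // => /eqP ->.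
rewrite -QE -v'E /v /v' !(linZ lc).
rewrite -[LHS](_ : chreg e * ftr (fun t => e * u * t * w) = _); last first.
  by rewrite kE; congr (_ * _); apply: eq_ftr => t; rewrite !mulrA.
rewrite (inner_trace_simple _ zbE ce zs).
by rewrite [RHS]mulrACA mulVf // mul1r.
Qed.

End Inner.

End Algebra.
End Positivity.

(** * The antipode is an involution *)

Section AntipodeInvolution.
Variables (K : closedFieldType) (H : falgType K) (D : hopf_structure H).
Notation "'\sw_' ( a , b <- h ) E" := (sw D (fun a b => E) h)
  (at level 41, E at level 41, a name, b name, h at level 50,
   format "'[' \sw_ ( a ,  b  <-  h ) '/  '  E ']'").
Local Notation eps := (counit D).
Local Notation S := (antipode D).
Local Notation phi := (antipode2 D).
Local Notation lam := (lint D).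
Local Notation chreg := (@regchar K H).
Hypothesis charK : [pchar K] =i pred0.
Hypothesis ssH : semisimple H.
Variable L : H.
Hypothesis intL : two_sided_integral D L.
Hypothesis epsL : eps L = 1.
Let lphi := lin_antipode2 D.
Let llam := lin_lint D.
Let lc := @lin_regchar K H.
(** [lam] is a trace twisted by phi and [chreg] is a trace, so the element u representing [lam]
    satisfies phi(c) u = u c. Nondegeneracy of [lam] makes u invertible. *)
Lemma antipode2_inner : exists u w, [/\ u * w = 1, w * u = 1 & forall x, phi x = u * x * w].
Proof.
have [u uE] := regchar_represents charK ssH llam.
have uphi c : phi c * u = u * c.
  apply: (regchar_inj charK ssH) => a.
  by rewrite -mulrA regcharC -mulrA -uE lint_twist uE mulrA.
have u0 b : u * b = 0 -> b = 0.
  move=> ub; apply: (lint_nondeg intL epsL) => a.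
  by rewrite uE mulrA ub mul0r (lin0 lc).
have [w uw] : exists w, u * w = 1 by apply: (inj_surj (f := fun x => u * x)); [lin|].
have wu : w * u = 1.
  by apply/eqP; rewrite -subr_eq0; apply/eqP/u0; rewrite mulrBr mulrA uw mul1r mulr1 subrr.
by exists u, w; split=> // x; rewrite -uphi -mulrA uw mulr1.
Qed.

(** The central idempotents L and 1 - L split Tr(phi) into 1 and a nonnegative cyclotomic number. *)
Lemma ftr_antipode2_neq0 : ftr phi != 0.
Proof.
have [u [w [uw wu phiE]]] := antipode2_inner.
have [M M0 phiMid] := antipode2_order intL epsL.
have [z zP] := closed_prim_root charK M0.
have uM : central (u ^+ M).
  have iterE k b : iter k phi b = u ^+ k * b * w ^+ k.
    elim: k => [|k IH]; first by rewrite mul1r mulr1.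
    by rewrite iterS IH phiE exprS exprSr !mulrA.
  have wuM k : w ^+ k * u ^+ k = 1.
    elim: k => [|k IH]; first by rewrite mul1r.
    by rewrite exprSr exprS mulrA -(mulrA _ w) wu mulr1.
  move=> b; rewrite -[X in _ = X * _]phiMid iterE.
  by rewrite -[RHS]mulrA wuM mulr1.
have LL : L * L = L by rewrite (intL _).1 epsL scale1r.
have cL : central L by move=> b; rewrite (intL _).1 (intL _).2.
have c1 : central (1 - L) by move=> b; rewrite mulrBl mulrBr mul1r mulr1 cL.
have i1 : (1 - L) * (1 - L) = 1 - L.
  by rewrite mulrBl !mulrBr !mul1r mulr1 LL subrr subr0.
have := nonneg_cyclotomic_1D charK M0 zP
  (nonneg_inner_trace charK M0 zP ssH uw wu uM c1 i1).
rewrite -[X in X + _](lint_L intL epsL) -ftrD; congr (_ != 0); apply: eq_ftr => x.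
by rewrite -phiE -mulrDl addrC subrK mul1r.
Qed.

Lemma regchar_L : chreg L = 1.
Proof.
rewrite /regchar (eq_ftr (g := fun x => (eps x : K) *: L)).
  by rewrite ftr_rank1 //; apply: lin_bundled.
by move=> x; rewrite (intL _).2.
Qed.

Lemma cotr_L : cotr D = (ftr phi : K) *: L.
Proof.
by rewrite -counit_cotr -(intL _).2 mul_cotr epsL scale1r.
Qed.

Lemma regchar_antipode2 x : chreg (phi x) = chreg x.
Proof.
have [u [w [uw wu phiE]]] := antipode2_inner.
by rewrite phiE regcharC mulrA wu mul1r.
Qed.

Lemma antipode_involutive : forall x, phi x = x.
Proof.
have pp := antipode2_invol intL epsL ftr_antipode2_neq0.
set n := \dim {:H}; have nK : n%:R != 0 :> K.
  rewrite natK_eq0 // dimv_eq0; apply/eqP => H0.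
  have : (1 : H) \in {:H}%VS by apply: memvf.
  by rewrite H0 memv0 oner_eq0.
have n2 : 2%:R != 0 :> K by rewrite natK_eq0.
(* Convolution with the idempotent chreg / dim H of the dual algebra. *)
pose E h : H := n%:R^-1 *: \sw_(a, b <- h) (chreg a : K) *: b.
have lE : linear E by rewrite /E; lin.
have EE x : E (E x) = E x.
  rewrite {1}/E {2}/E; rewrite (linZ (lin_sw _ _)) scalerA.
  rewrite (sw_comp _ _ (f := fun z => \sw_(a, b <- z) (chreg a : K) *: b)); last by lin.
  under eq_sw => a b.
    rewrite (linZ (lin_sw _ _)) -sw_scale.
    over.
  rewrite -(@swA _ _ D _ (fun a b c => (chreg a : K) *: ((chreg b : K) *: c))); [|lin..].
  have -> : \sw_(u, c <- x) \sw_(a, b <- u) (chreg a : K) *: ((chreg b : K) *: c) =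
      \sw_(u, c <- x) n%:R *: ((chreg u : K) *: c).
    apply: eq_sw => u c; rewrite scalerA -regchar1 -[_ * _](regchar_conv D u).
    rewrite (sw_comp _ _ (f := fun k : K^o => (k : K) *: c)); last by lin.
    by apply: eq_sw => a b; rewrite scalerA mulrC.
  by rewrite sw_scale scalerA -mulrA mulVf // mulr1.
have Ephi x : E (phi x) = phi (E x).
  rewrite /E (linZ lphi) (sw_comp _ _ _ lphi) sw_antipode2; last by lin.
  by congr (_ *: _); apply: eq_sw => a b; rewrite regchar_antipode2 (linZ lphi).
(* The value of [chreg] on [cotr], once from [cotr_L] and once as a trace. *)
have tE : ftr phi = n%:R * ftr (fun x => phi (E x)).
  transitivity (chreg (cotr D)).
    by rewrite cotr_L (linZ lc) regchar_L [RHS]mulr1.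
  rewrite (cotrE D lc) -ftrZ; apply: eq_ftr => x.
  rewrite /E (linZ lphi) scalerA divff // scale1r (sw_comp _ _ _ lphi).
  by apply: eq_sw => a b; rewrite (linZ lphi).
(* The projection onto the fixed space of phi. It commutes with [E], so [Q], [E] and their composite
   have ranks as traces. *)
pose Q x := 2%:R^-1 *: (x + phi x).
have lQ : linear Q by rewrite /Q; lin.
have QQ x : Q (Q x) = Q x.
  rewrite /Q (linZ lphi) (linD lphi) pp -scalerDr (addrC (phi x)) -mulr2n.
  by congr (_ *: _); rewrite -scaler_nat scalerA mulVf // scale1r.
have EQ x : E (Q x) = Q (E x) by rewrite /Q (linZ lE) (linD lE) Ephi.
have [W [WE WQ WQ']] := ftr_idem lQ QQ.
have [W1 [W1E _ _]] := ftr_idem lE EE.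
have [||W2 [W2E _ _]] := @ftr_idem K H (fun x => Q (E x)).
- by move=> a x y; rewrite lE lQ.
- by move=> x; rewrite EQ EE QQ.
have traceQ (f : H -> H) : ftr (fun x => Q (f x)) *+ 2 = ftr f + ftr (fun x => phi (f x)).
  by rewrite -ftrD /Q ftrZ -[LHS]mulr_natl mulrA divff // mul1r.
have qE := traceQ id; have q'E := traceQ E.
have W0 : (0 < \dim W)%N.
  rewrite lt0n dimv_eq0; apply/eqP => W0; have := WQ 1.
  rewrite W0 memv0 /Q antipode2_1 -mulr2n -scaler_nat scalerA mulVf // scale1r.
  by rewrite oner_eq0.
rewrite ftr_id WE -/n in qE; rewrite W2E W1E in q'E.
(* The trace equations for [Q] and for [Q] after [E], combined through [tE] into an equation of
   natural numbers; it shows that n divides 2 dim W. *)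
have eqn : (n * (\dim W2).*2 + n = n * \dim W1 + (\dim W).*2)%N.
  apply: (natK_inj charK); rewrite !natrD !natrM -!muln2 !natrM !mulr_natr qE q'E.
  by rewrite mulrDr -tE addrAC addrA mulr_natr.
have tW : (\dim W).*2 != n.
  apply: contraNneq ftr_antipode2_neq0 => Wn.
  by move: qE; rewrite -mulrnA muln2 Wn -{1}[n%:R]addr0 => /addrI <-.
have Wn : (\dim W = n)%N.
  have [k kE] : exists k, ((\dim W).*2 = k * n)%N.
    by apply/dvdnP; rewrite -(dvdn_addr _ (dvdn_mulr (\dim W1) (dvdnn n))) -eqn
      dvdn_addr ?dvdn_mulr.
  have leWn : (\dim W <= n)%N by apply/dimvS/subvf.
  (* Of the multiples k n, k = 0 is excluded because Q fixes 1, k = 1 because Tr(phi) is nonzero,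
     and k > 2 by dim W <= n. *)
  case: k kE tW => [|[|[|k]]] kE; rewrite kE ?mul1n ?eqxx // => _.
  - by move: W0; rewrite -double_gt0 kE.
  - by apply: double_inj; rewrite kE mul2n.
  have n0 : (0 < n)%N by apply: leq_trans leWn.
  by move: leWn; rewrite -leq_double kE -mul2n leq_pmul2r.
have QE x : Q x = x.
  apply: WQ'; suff -> : W = {:H}%VS by apply: memvf.
  by apply/eqP; rewrite -dimv_leqif_eq ?subvf // Wn.
move=> x; have := congr1 (fun y => 2%:R *: y) (QE x).
by rewrite scalerA divff // scale1r scaler_nat mulr2n => /addrI.
Qed.

(** With phi = id, p (x) q on the coproduct of [cotr] is the trace of a composite of two convolution
    operators, hence symmetric in p and q. Dividing by Tr(phi) passes to L. *)
Lemma integral_cocomm (W : lmodType K) (F : H -> H -> W) : bilin F ->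
  sw D F L = \sw_(a, b <- L) F b a.
Proof.
have cotrC (p q : H -> K^o) : linear p -> linear q ->
    \sw_(a, b <- cotr D) (p a : K) *: q b = \sw_(a, b <- cotr D) (q a : K) *: p b.
  move=> lp lq; pose E (r : H -> K^o) x : H := \sw_(a, b <- x) (r a : K) *: b.
  have lE r : linear r -> linear (E r) by rewrite /E => lr; lin.
  have EE (r s : H -> K^o) : linear r -> linear s ->
      \sw_(a, b <- cotr D) (r a : K) *: s b = ftr (fun x => E s (E r x)).
    move=> lr ls; rewrite (cotrE D (p := fun z => \sw_(a, b <- z) (r a : K) *: s b));
      last by lin.
    apply: eq_ftr => x; transitivity (\sw_(u, c <- x) \sw_(a, b <- u)
       (r a : K) *: ((s b : K) *: c)).
      apply: eq_sw => u c; rewrite antipode_involutive.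
      rewrite (sw_comp _ _ (f := fun k : K^o => (k : K) *: c)); last by lin.
      by apply: eq_sw => a b; rewrite scalerA.
    rewrite (@swA _ _ D _ (fun a b c => (r a : K) *: ((s b : K) *: c))); [|lin..].
    rewrite [E r x]/E (sw_comp _ _ _ (lE s ls)).
    by apply: eq_sw => a b; rewrite (linZ (lE s ls)) sw_scale.
  by rewrite (EE p q) // (EE q p) // ftrC //; apply: lE.
have LC (p q : H -> K^o) : linear p -> linear q ->
    \sw_(a, b <- L) (p a : K) *: q b = \sw_(a, b <- L) (q a : K) *: p b.
  move=> lp lq; have := cotrC p q lp lq; rewrite cotr_L !(linZ (lin_sw _ _)).
  by move/(scalerI ftr_antipode2_neq0).
(* Expanding F in coordinate functionals reduces it to the case p (x) q. *)
move=> bF; pose e := vbasis {:H}.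
pose cd (i : 'I_(\dim {:H})) : H -> K^o := coord e i.
have lcd i : linear (cd i) by apply: lin_bundled.
have FE a b : F a b = \sum_i \sum_j ((cd i a : K) *: cd j b : K) *: F e`_i e`_j.
  rewrite [a in LHS](coord_vbasis (memvf a)) (lin_sum (lin_bl b bF)).
  apply: eq_bigr => i _; rewrite (linZ (lin_bl b bF)).
  rewrite [b in LHS](coord_vbasis (memvf b)) (lin_sum (lin_br _ bF)) scaler_sumr.
  by apply: eq_bigr => j _; rewrite (linZ (lin_br _ bF)) scalerA.
have swF (G : H -> H -> W) i j :
    \sw_(a, b <- L) (((cd i a : K) *: cd j b : K) *: F e`_i e`_j) =
    ((\sw_(a, b <- L) (cd i a : K) *: cd j b) : K) *: F e`_i e`_j.
  by rewrite (sw_comp _ _ (f := fun k : K^o => (k : K) *: F e`_i e`_j)) //; lin.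
have sw_bigsum (I : Type) (r : seq I) (G : I -> H -> H -> W) :
    \sw_(a, b <- L) (\sum_(i <- r) G i a b) = \sum_(i <- r) sw D (G i) L.
  rewrite /sw /tlift2 /tlift [RHS]exchange_big; apply: eq_bigr => f _ /=.
  by rewrite scaler_sumr.
transitivity (\sum_i \sum_j ((\sw_(a, b <- L) (cd i a : K) *: cd j b) : K) *: F e`_i e`_j).
  under eq_sw => a b do rewrite FE.
  rewrite sw_bigsum; apply: eq_bigr => i _; rewrite sw_bigsum.
  by apply: eq_bigr => j _; rewrite swF.
under [RHS]eq_sw => a b do rewrite FE.
rewrite sw_bigsum; apply: eq_bigr => i _; rewrite sw_bigsum.
apply: eq_bigr => j _; rewrite LC //.
rewrite (sw_comp _ _ (f := fun k : K^o => (k : K) *: F e`_i e`_j)); last by lin.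
by apply: eq_sw => a b; congr (_ *: _); rewrite [LHS]mulrC.
Qed.
End AntipodeInvolution.

(** * Tensor powers *)

Section Multilinear.
Variables (K : fieldType) (U : vectType K) (W : lmodType K).

Lemma tset_cons m (a x : U) (v : m.-tuple U) i :
  [tuple of a :: tset v i x] = tset [tuple of a :: v] (lift ord0 i) x.
Proof.
apply: eq_from_tnth => j; rewrite tnth_mktuple.
case: (unliftP ord0 j) => [k ->|->]; rewrite ?tnth0 //.
by rewrite !tnthS tnth_mktuple (inj_eq lift_inj).
Qed.

Lemma tset_head m (a x : U) (v : m.-tuple U) :
  [tuple of x :: v] = tset [tuple of a :: v] ord0 x.
Proof.
apply: eq_from_tnth => j; rewrite tnth_mktuple.
by case: (unliftP ord0 j) => [k ->|->]; rewrite ?tnth0 ?tnthS.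
Qed.

Lemma nth_tset m (v : m.-tuple U) i x j :
  nth 0 (tset v i x) j = if j == i then x else nth 0 v j.
Proof.
have [jm|jm] := ltnP j m.
  by rewrite -[j in LHS]/(val (Ordinal jm)) -tnth_nth tnth_mktuple (tnth_nth 0).
rewrite !nth_default ?size_tuple //; case: eqP => // ji.
by move: (ltn_ord i); rewrite ltnNge -ji jm.
Qed.

Lemma tset_rcons m (b x : U) (v : m.-tuple U) i :
  [tuple of rcons (tset v i x) b] =
  tset [tuple of rcons v b] (widen_ord (leqnSn m) i) x.
Proof.
apply: eq_from_tnth => j; rewrite !(tnth_nth 0) nth_tset /= !nth_rcons.
rewrite !size_tuple ?card_ord nth_tset; case: ltnP => // jm.
by rewrite (gtn_eqF (leq_trans (ltn_ord i) jm)).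
Qed.

Lemma tset_last m (b x : U) (v : m.-tuple U) :
  [tuple of rcons v x] = tset [tuple of rcons v b] ord_max x.
Proof.
apply: eq_from_tnth => j; rewrite !(tnth_nth 0) nth_tset /= !nth_rcons.
by rewrite !size_tuple; case: ltngtP.
Qed.

Section Tails.
Variables (m : nat) (g : m.+1.-tuple U -> W).
Hypothesis mg : multilinear g.

Lemma multilinear_cons a : multilinear (fun v : m.-tuple U => g [tuple of a :: v]).
Proof. by move=> v i c x z; rewrite /= !tset_cons mg. Qed.

Lemma lin_head (v : m.-tuple U) : linear (fun x => g [tuple of x :: v]).
Proof. by move=> c x z; rewrite /= (tset_head 0 (_ + _)) (tset_head 0 x) (tset_head 0 z) mg. Qed.

Lemma multilinear_rcons b : multilinear (fun v : m.-tuple U => g [tuple of rcons v b]).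
Proof. by move=> v i c x z; rewrite /= !tset_rcons mg. Qed.

Lemma lin_last (v : m.-tuple U) : linear (fun x => g [tuple of rcons v x]).
Proof. by move=> c x z; rewrite /= (tset_last 0 (_ + _)) (tset_last 0 x) (tset_last 0 z) mg. Qed.

End Tails.

Lemma multilinear_rot m (g : m.+1.-tuple U -> W) : multilinear g ->
  multilinear (fun v => g [tuple of rot 1 v]).
Proof.
move=> mg v; case/tupleP: v => b v i.
pose r (w : m.+1.-tuple U) := [tuple of rot 1 w].
have rotE y (w : m.-tuple U) : r [tuple of y :: w] = [tuple of rcons w y].
  by apply: val_inj; rewrite /= rot1_cons.
suff: linear (fun y => g (r (tset [tuple of b :: v] i y))) by [].
move=> c x z; case: (unliftP ord0 i) => [k ->|->].
  by rewrite -!tset_cons !rotE (multilinear_rcons mg).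
by rewrite -!tset_head !rotE (lin_last mg).
Qed.

End Multilinear.

(** * Sweedler sums with any number of factors *)

Section IteratedSweedler.
Variables (K : fieldType) (H : falgType K) (D : hopf_structure H).
Notation "'\sw_' ( a , b <- h ) E" := (sw D (fun a b => E) h)
  (at level 41, E at level 41, a name, b name, h at level 50,
   format "'[' \sw_ ( a ,  b  <-  h ) '/  '  E ']'").
Local Notation eps := (counit D).
Local Notation S := (antipode D).
Section IteratedCoproduct.
Variable W : lmodType K.

Definition swn n (g : n.+1.-tuple H -> W) (h : H) : W := tlift g (iter_comul D n h).

Lemma lin_swn n g : linear (@swn n g).
Proof.
move=> a x z; have E := sweedler_is_linear D n.+1 a x z; rewrite /= in E.
rewrite /swn E.
exact: lin_tlift.
Qed.

Lemma swn0 g h : multilinear g -> @swn 0 g h = g [tuple h].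
Proof. by move=> mg; rewrite /swn tlift_tens. Qed.

Lemma eq_swn n g g' h : g =1 g' -> @swn n g h = swn g' h.
Proof. exact: eq_tlift. Qed.

Lemma swnS n g h : multilinear g ->
  @swn n.+1 g h = \sw_(a, b <- h) swn (fun v => g [tuple of a :: v]) b.
Proof.
move=> mg; rewrite /swn /= -/(sw D _ _) (sw_comp _ _ _ (lin_tlift _)).
apply: eq_sw => a b; rewrite /tcons tlift_comp; last exact: lin_tlift.
by apply: eq_tlift => v; rewrite tlift_tens.
Qed.

Lemma lin_swnF n (V : lmodType K) (g : V -> n.+1.-tuple H -> W) h :
  (forall v, linear (g^~ v)) -> linear (fun x => swn (g x) h).
Proof. by move=> lg; apply: lin_bigsum => f; apply: lin_scaler; apply: lg. Qed.

Lemma swn_sw n (g : n.+1.-tuple H -> H -> H -> W) h k :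
  swn (fun v => sw D (g v) k) h = \sw_(a, b <- k) swn (fun v => g v a b) h.
Proof.
rewrite /swn /sw /tlift2 /tlift.
under eq_bigr => i _ do rewrite scaler_sumr.
rewrite exchange_big; apply: eq_bigr => i _; rewrite scaler_sumr.
by apply: eq_bigr => j _; rewrite !scalerA mulrC.
Qed.

(** [iter_comul] splits off the first factor; coassociativity lets the last one be split off
    instead. *)
Lemma swn_rcons n g h : multilinear g ->
  @swn n.+1 g h = \sw_(a, b <- h) swn (fun v => g [tuple of rcons v b]) a.
Proof.
elim: n => [|n IH] in g h * => mg.
  rewrite swnS //; apply: eq_sw => a b.
  rewrite !swn0; [|exact: multilinear_rcons|exact: multilinear_cons].
  by congr g; apply: val_inj.
rewrite swnS //; under eq_sw => a u.
  rewrite IH; last exact: multilinear_cons.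
  over.
rewrite -(@swA _ _ D _ (fun a c b =>
   swn (fun v => g [tuple of a :: [tuple of rcons v b]]) c)).
- apply: eq_sw => w b; rewrite swnS; last exact: multilinear_rcons.
  apply: eq_sw => a c; apply: eq_swn => v.
  by congr g; apply: val_inj.
- by move=> c b; apply: lin_swnF => v; apply: lin_head.
- by move=> a b; apply: lin_swn.
move=> a c; apply: lin_swnF => v.
exact: (lin_last (multilinear_cons mg a)).
Qed.

Definition mulT n (u v : n.-tuple H) : n.-tuple H := [tuple tnth u i * tnth v i | i < n].

Lemma mulT_cons n a b (u v : n.-tuple H) :
  mulT [tuple of a :: u] [tuple of b :: v] = [tuple of a * b :: mulT u v].
Proof.
apply: eq_from_tnth => j; rewrite tnth_mktuple.
by case: (unliftP ord0 j) => [k ->|->]; rewrite ?tnth0 // !tnthS tnth_mktuple.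
Qed.

Lemma mulT_setl n (u v : n.-tuple H) i x :
  mulT (tset u i x) v = tset (mulT u v) i (x * tnth v i).
Proof.
apply: eq_from_tnth => j; rewrite !tnth_mktuple.
by case: eqP => // ->.
Qed.

Lemma mulT_setr n (u v : n.-tuple H) i x :
  mulT u (tset v i x) = tset (mulT u v) i (tnth u i * x).
Proof.
apply: eq_from_tnth => j; rewrite !tnth_mktuple.
by case: eqP => // ->.
Qed.

Lemma multilinear_mulTr n (g : n.-tuple H -> W) u : multilinear g ->
  multilinear (fun v => g (mulT u v)).
Proof.
by move=> mg v i a x z; rewrite /= !mulT_setr mulrDr -scalerAr mg.
Qed.

Lemma multilinear_mulTl n (g : n.-tuple H -> W) v : multilinear g ->
  multilinear (fun u => g (mulT u v)).
Proof.
by move=> mg u i a x z; rewrite /= !mulT_setl mulrDl -scalerAl mg.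
Qed.

Lemma swnM n g x y : multilinear g ->
  @swn n g (x * y) = swn (fun u => swn (fun v => g (mulT u v)) y) x.
Proof.
elim: n => [|n IH] in g x y * => mg.
  rewrite swn0 // swn0; last first.
    by move=> u i; apply: lin_swnF => v; apply: multilinear_mulTl.
  rewrite swn0; last exact: multilinear_mulTr.
  by congr g; apply: eq_from_tnth => i; rewrite tnth_mktuple !ord1.
rewrite swnS // (swM D (F := fun a b => swn (fun v => g [tuple of a :: v]) b));
  last first.
  split=> [b|a]; last exact: lin_swn.
  by apply: lin_swnF => v; apply: lin_head.
rewrite swnS; last first.
  by move=> u i; apply: lin_swnF => v; apply: multilinear_mulTl.
apply: eq_sw => a b; under [RHS]eq_swn => u.
  rewrite swnS; last exact: multilinear_mulTr.
  over.
rewrite swn_sw; apply: eq_sw => c d; rewrite IH; last exact: multilinear_cons.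
by apply: eq_swn => u; apply: eq_swn => v; rewrite mulT_cons.
Qed.

(** Split off the last factor and exchange the two parts by cocommutativity: the factor split off is
    now the first. *)
Lemma swn_rot n g (L : H) : multilinear g ->
    (forall F : H -> H -> W, bilin F -> sw D F L = \sw_(a, b <- L) F b a) ->
  @swn n g L = swn (fun v => g [tuple of rot 1 v]) L.
Proof.
move=> mg cocL; case: n g mg => [|n] g mg.
  by apply: eq_swn => v; congr g; apply: val_inj; rewrite /= rot_oversize ?size_tuple.
rewrite swn_rcons // cocL; last first.
  split=> [b|a]; last by apply: lin_swnF => v; apply: lin_last.
  exact: lin_swn.
rewrite swnS; last exact: multilinear_rot.
apply: eq_sw => a b; apply: eq_swn => v; congr g; apply: val_inj.
by rewrite /= rot1_cons.
Qed.
End IteratedCoproduct.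
End IteratedSweedler.

Lemma tnth_rot1 T m (w : m.-tuple T) j : tnth [tuple of rot 1 w] j = tnth w (ordS j).
Proof.
have x0 := tnth w j; case: m w j x0 => [|m] w j x0; first by case: j.
rewrite !(tnth_nth x0) /=; case/tupleP: w => a w.
rewrite rot1_cons nth_rcons size_tuple; have := ltn_ord j; rewrite ltnS leq_eqVlt.
case/orP => [/eqP -> | jm]; first by rewrite ltnn eqxx modnn.
by rewrite jm modn_small.
Qed.

(** * Maps on tensor powers in coordinates and the trace of the cyclic shift *)

Section TensorMaps.
Variables (K : fieldType) (V : vectType K).
Local Notation e := (vbasis {:V}).
Local Notation d := (\dim {:V}).
Implicit Types (m : nat).

Definition basisT m (k : m.-tuple 'I_d) : m.-tuple V := [tuple e`_(tnth k i) | i < m].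

Lemma tensor_expand m (t : tpow K V m) : t = \sum_k (t k : K) *: tens (basisT k).
Proof.
apply/ffunP => f; rewrite sum_ffunE (bigD1 f) //= big1.
  rewrite addr0 ffunE ffunE big1 ?[RHS]mulr1 // => i _.
  by rewrite tnth_mktuple coord_free ?eqxx // (basis_free (vbasisP _)).
move=> k kf; rewrite ffunE ffunE.
have [i ki] : exists i, tnth k i != tnth f i.
  apply/existsP; apply: contraR kf; rewrite negb_exists => /forallP kf.
  by apply/eqP/eq_from_tnth => i; apply/eqP; rewrite -[_ == _]negbK.
rewrite (bigD1 i) //= tnth_mktuple coord_free ?(basis_free (vbasisP _)) //.
by rewrite (negPf ki) mul0r scaler0.
Qed.

Lemma eq_tensor_map m (W : lmodType K) (F G : tpow K V m -> W) :
  linear F -> linear G -> (forall v, F (tens v) = G (tens v)) -> F =1 G.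
Proof.
move=> lF lG FG t; rewrite (tensor_expand t) (lin_sum lF) (lin_sum lG).
by apply: eq_bigr => k _; rewrite (linZ lF) (linZ lG) FG.
Qed.

Lemma ftr_tensor m (F : tpow K V m -> tpow K V m) : linear F ->
  ftr F = \sum_k F (tens (basisT k)) k.
Proof.
move=> lF; apply: (ftr_family (c := fun k (t : tpow K V m) => t k)) => //.
  by move=> k a x z; rewrite !ffunE.
exact: tensor_expand.
Qed.

Lemma tmap_tens m (f : m.-tuple 'End(V)) (v : m.-tuple V) :
  tmap f (tens v) = tens [tuple tnth f i (tnth v i) | i < m].
Proof.
rewrite lfunE /= tlift_tens // => u i a x z /=.
have E y : [tuple tnth f j (tnth (tset u i y) j) | j < m] =
    tset [tuple tnth f j (tnth u j) | j < m] i (tnth f i y).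
  by apply: eq_from_tnth => j; rewrite !tnth_mktuple; case: eqP => // ->.
by rewrite !E linearP tens_multilinear.
Qed.

Lemma tcycle_tmap m (f : m.-tuple 'End(V)) t :
  tcycle V m (tmap f t) = tmap [tuple of rot 1 f] (tcycle V m t).
Proof.
apply: (eq_tensor_map (F := fun t => tcycle V m (tmap f t))
  (G := fun t => tmap [tuple of rot 1 f] (tcycle V m t))).
- by move=> a x z; rewrite !linearP.
- by move=> a x z; rewrite !linearP.
move=> v; rewrite tmap_tens !tcycle_tens tmap_tens; congr tens.
apply: eq_from_tnth => j; rewrite tnth_mktuple.
by rewrite !tnth_rot1 tnth_mktuple.
Qed.

(* k_0 is preceded by j: the factors are the matrix entries along the path
   j, k_0, k_1, ... *)
Fixpoint path_prod (j : 'I_d) (s : seq ('End(V) * 'I_d)) : K :=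
  if s is (f, k) :: s' then coord e j (f e`_k) * path_prod k s' else 1.

Lemma path_prodE m (f : m.-tuple 'End(V)) (k : m.-tuple 'I_d) j :
  \prod_(i < m) coord e (nth j (j :: k) i) (tnth f i e`_(tnth k i)) =
  path_prod j (zip f k).
Proof.
elim: m f k j => [|m IH] f k j; first by rewrite big_ord0 tuple0 (tuple0 k).
case/tupleP: f => f0 f; case/tupleP: k => k0 k.
rewrite big_ord_recl /= !tnth0; congr (_ * _); rewrite -IH.
apply: eq_bigr => i _; rewrite !tnthS /=; congr (coord _ _ _).
by case: i => -[|i] ilt //=; apply: set_nth_default; rewrite size_tuple ltnW.
Qed.

(** Summing over intermediate indices is matrix multiplication. *)
Lemma sum_path_prod n (f : seq 'End(V)) j l : size f = n.+1 ->
  \sum_(k : n.-tuple 'I_d) path_prod j (zip f (rcons k l)) =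
  coord e j (foldr (fun (g : 'End(V)) x => g x) e`_l f).
Proof.
elim: n f j => [|n IH] [|g f] // j [].
  case: f => // _; rewrite (bigD1 [tuple]) //= big1 ?addr0 ?mulr1 //.
  by move=> k /eqP[]; apply: tuple0.
move=> sf; pose h (p : 'I_d * n.-tuple 'I_d) := [tuple of p.1 :: p.2].
have hbij : bijective h.
  exists (fun f : n.+1.-tuple _ => (thead f, [tuple of behead f])).
    by case=> i k; congr pair; apply: val_inj.
  by case/tupleP=> i k; apply: val_inj.
rewrite (reindex h) /=; last exact: onW_bij.
rewrite -(pair_big predT predT (fun (i : 'I_d) (k : n.-tuple 'I_d) => coord e j (g e`_i) *
   path_prod i (zip f (rcons (val k) l)))) /=.
set x := foldr _ _ f; rewrite [in RHS](coord_vbasis (memvf x)) !linear_sum.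
apply: eq_bigr => i _; rewrite -big_distrr /= IH // !linearZ /=.
by rewrite mulrC.
Qed.

(** Each diagonal coefficient is a product of matrix entries along a closed path of indices, as in
    the trace of a matrix product. *)
Lemma ftr_tcycle_tmap m (f : m.-tuple 'End(V)) : (0 < m)%N ->
  ftr (fun t => tcycle V m (tmap f t)) = ftr (fun x => foldr (fun (g : 'End(V)) y => g y) x f).
Proof.
case: m f => // n f _; rewrite ftr_tensor; last by move=> a x z; rewrite !linearP.
(* The last index is split off because the shift also puts it at the start of the path. *)
pose h (p : n.-tuple 'I_d * 'I_d) := [tuple of rcons p.1 p.2].
have hbij : bijective h.
  apply: inj_card_bij; last by rewrite card_prod !card_tuple card_ord expnSr.
  by move=> [k l] [k' l'] /(congr1 val) /rcons_inj[/val_inj -> ->].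
rewrite (reindex h) /=; last exact: onW_bij.
rewrite -(pair_big predT predT (fun (k : n.-tuple 'I_d) (l : 'I_d) => tcycle V n.+1 (tmap f (tens (basisT (h (k, l))))) (h (k, l)))) /=.
rewrite exchange_big /ftr; apply: eq_bigr => l _.
rewrite -(@sum_path_prod n) ?size_tuple //; apply: eq_bigr => k _.
rewrite tmap_tens tcycle_tens tens_rot ffunE.
rewrite -[rcons k l]/(val (h (k, l))) -path_prodE; apply: eq_bigr => i _.
rewrite !tnth_mktuple.
have -> // : tnth [tuple of rotr 1 (h (k, l))] i = nth l (l :: h (k, l)) i.
rewrite (tnth_nth l) /= rotr1_rcons.
by rewrite -cats1 -cat_cons nth_cat /= size_tuple ltn_ord.
Qed.

End TensorMaps.
Section Sweedler.
Variables (K : fieldType) (H : falgType K) (D : hopf_structure H).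
Notation "'\sw_' ( a , b <- h ) E" := (sw D (fun a b => E) h)
  (at level 41, E at level 41, a name, b name, h at level 50,
   format "'[' \sw_ ( a ,  b  <-  h ) '/  '  E ']'").
Local Notation eps := (counit D).
Local Notation S := (antipode D).
End Sweedler.

(** * Invariants of tensor powers and the indicator as a trace *)

Section Invariants.
Variables (K : fieldType) (H : falgType K) (D : hopf_structure H).
Notation "'\sw_' ( a , b <- h ) E" := (sw D (fun a b => E) h)
  (at level 41, E at level 41, a name, b name, h at level 50,
   format "'[' \sw_ ( a ,  b  <-  h ) '/  '  E ']'").
Local Notation eps := (counit D).
Local Notation S := (antipode D).
Lemma swn_ftr (U : vectType K) n (F : n.+1.-tuple H -> U -> U) h :
  swn D (fun u => ftr (F u)) h = ftr (fun t => swn D (fun u => F u t) h).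
Proof. by rewrite /swn /tlift ftr_sum; apply: eq_bigr => i _; rewrite ftrZ. Qed.

Lemma lin_lfun (U V : vectType K) (f : 'Hom(U, V)) : linear f.
Proof. by move=> a x z; rewrite linearP. Qed.

Section TensorAction.
Variables (V : vectType K) (rho : hmodule H V).

Definition actT n (u : n.-tuple H) : 'End(tpow K V n) :=
  tmap [tuple rho (tnth u i) | i < n].

Lemma actT_tens n (u : n.-tuple H) v :
  actT u (tens v) = tens [tuple rho (tnth u i) (tnth v i) | i < n].
Proof.
by rewrite /actT tmap_tens; congr tens; apply: eq_from_tnth => i; rewrite !tnth_mktuple.
Qed.

Lemma multilinear_actT n : multilinear (@actT n).
Proof.
move=> u i a x z; apply/lfunP => t; rewrite add_lfunE scale_lfunE; move: t.
apply: eq_tensor_map => [||v]; first exact: lin_lfun.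
  by apply: lin_add; [apply: lin_scaler|]; apply: lin_lfun.
have E y : [tuple rho (tnth (tset u i y) j) (tnth v j) | j < n] =
    tset [tuple rho (tnth u j) (tnth v j) | j < n] i (rho y (tnth v i)).
  by apply: eq_from_tnth => j; rewrite !tnth_mktuple; case: eqP => // ->.
rewrite !actT_tens !E linearP add_lfunE scale_lfunE.
by rewrite tens_multilinear.
Qed.

Lemma actT_mul n (u v : n.-tuple H) t : actT (mulT u v) t = actT u (actT v t).
Proof.
move: t; apply: eq_tensor_map => [b s t|b s t|w]; [by rewrite linearP|by rewrite !linearP|].
rewrite !actT_tens; congr tens; apply: eq_from_tnth => i.
by rewrite !tnth_mktuple hactM lfunE.
Qed.

Lemma lin_eval (U : vectType K) (t : U) : linear (fun F : 'End(U) => F t).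
Proof. by move=> a F G; rewrite add_lfunE scale_lfunE. Qed.

Lemma tpow_actE n h t : tpow_act D rho n.+1 h t = swn D (fun u => actT u t) h.
Proof.
rewrite /tpow_act [LHS](tlift_comp (f := fun F : 'End(tpow K V n.+1) => F t)) //.
exact: lin_eval.
Qed.

Lemma multilinear_actT_eval n t : multilinear (fun u : n.-tuple H => actT u t).
Proof.
by move=> u i a x z /=; rewrite (multilinear_actT u i a x z) add_lfunE scale_lfunE.
Qed.

Lemma tpow_actM n x y t :
  tpow_act D rho n.+1 (x * y) t = tpow_act D rho n.+1 x (tpow_act D rho n.+1 y t).
Proof.
rewrite !tpow_actE swnM; last exact: multilinear_actT_eval.
apply: eq_swn => u; rewrite /swn (tlift_comp (f := fun s => actT u s)).
  by apply: eq_tlift => v; rewrite actT_mul.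
by move=> a s s'; rewrite linearP.
Qed.

Lemma tcycle_actT n (u : n.-tuple H) t :
  tcycle V n (actT u t) = actT [tuple of rot 1 u] (tcycle V n t).
Proof.
rewrite /actT tcycle_tmap; congr (tmap _ _).
by apply: eq_from_tnth => i; rewrite tnth_rot1 !tnth_mktuple tnth_rot1.
Qed.

Lemma hact_prod n (u : n.-tuple H) x :
  foldr (fun (g : 'End(V)) y => g y) x [tuple rho (tnth u i) | i < n] =
  rho (\prod_(y <- u) y) x.
Proof.
have -> : [tuple rho (tnth u i) | i < n] = map rho u :> seq _.
  by rewrite -[in RHS](map_tnth_enum u) -map_comp.
elim: (val u) => [|y s IH]; first by rewrite big_nil hact1 lfunE.
by rewrite big_cons hactM lfunE /= IH.
Qed.

Variable L : H.
Hypothesis intL : two_sided_integral D L.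
Hypothesis epsL : eps L = 1.
Hypothesis cocommL : forall (W : lmodType K) (F : H -> H -> W), bilin F ->
  sw D F L = \sw_(a, b <- L) F b a.

(** The action P of L projects onto the invariants and commutes with alpha. The trace of alpha on
    them is thus that of alpha P on the whole space, a Sweedler sum of traces given by
    [ftr_tcycle_tmap]. *)
Lemma FS_indicator_trace m : (0 < m)%N ->
  FS_indicator D L m (hchar rho) = lftrace (lfrestr (tpow_invariants D rho m) (tcycle V m)).
Proof.
case: m => // n _; set W := tpow_invariants D rho n.+1; set al := tcycle V n.+1.
pose P := tpow_act D rho n.+1 L.
have PW t : P t \in W.
  apply/tpow_invariantsP => h; rewrite -tpow_actM (intL h).1 !tpow_actE.
  by rewrite (linZ (lin_swn _ _)).
have PWid w : w \in W -> P w = w by move/tpow_invariantsP/(_ L); rewrite epsL scale1r.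
(* alpha rotates the factors of L along with the tensor, and [swn_rot] rotates them back. *)
have alP t : al (P t) = P (al t).
  rewrite /P !tpow_actE (swn_rot (L := L) (g := fun u => actT u (al t))); last 2 first.
  - exact: multilinear_actT_eval.
  - exact: cocommL.
  rewrite /swn (tlift_comp (f := fun s => al s)); last exact: lin_lfun.
  by apply: eq_tlift => u; rewrite tcycle_actT.
(* P is the identity on W, so it can be inserted before alpha; as alpha P has its values in W, the
   trace extends to the whole space. *)
rewrite lftrace_ftr (eq_ftr (g := fun x => vsproj W (al (P (vsval x))))); last first.
  by move=> x; rewrite lfunE /= PWid ?subvsP.
rewrite -(ftr_subvs (f := fun t => al (P t))); last 2 first.
- by move=> a s t; rewrite !linearP.
- by move=> t; rewrite alP PW.
have -> : ftr (fun t => al (P t)) = swn D (fun u => ftr (fun t => al (actT u t))) L.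
  rewrite swn_ftr; apply: eq_ftr => t; rewrite /P tpow_actE /swn.
  by rewrite (tlift_comp (f := fun s => al s)) //; apply: lin_lfun.
rewrite /FS_indicator /hopf_power /swn (tlift_comp (f := fun h => hchar rho h : K^o)) /=.
  apply: (@eq_tlift K H K^o n.+1) => u; rewrite ftr_tcycle_tmap // /hchar lftrace_ftr.
  by apply: eq_ftr => x; rewrite hact_prod.
move=> a x z; rewrite /hchar !lftrace_ftr.
apply: (lin_ftr (F := fun h v => rho h v)) => v b y w.
by rewrite linearP add_lfunE scale_lfunE.
Qed.

End TensorAction.
End Invariants.

Theorem corollary2p3 (K : closedFieldType) (charK : [pchar K] =i pred0)
    (H : falgType K) (D : hopf_structure H) (ssH : semisimple H)
    (L : H) (intL : two_sided_integral D L) (epsL : counit D L = 1)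
    (V : vectType K) (rho : hmodule H V) (m : nat) (m_gt0 : (0 < m)%N) :
  FS_indicator D L m (hchar rho) =
  lftrace (lfrestr (tpow_invariants D rho m) (tcycle V m)).
Proof.
apply: FS_indicator_trace => // W F bF.
exact: (integral_cocomm charK ssH intL epsL bF).
Qed.
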